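(* Let $\mathbf{u}=(e^{i\varphi_1},e^{i\varphi_2},e^{i\varphi_3})\in T^3$. (i) One obtains a hermitian projection $e\in M_4(C_{\mathrm{alg}}(S^4_{\mathbf{u}}))$ (that is, $e=e^2=e^*$) by setting $e=\frac12\big(\mathbf 1+\sum_{\mu=0}^3\tilde\gamma_\mu u^\mu+\gamma u\big)$. Furthermore one has $\mathrm{ch}_0(e)=0$ and $\mathrm{ch}_1(e)=0$. (ii) One obtains a unitary $U\in M_2(C_{\mathrm{alg}}(S^3_{\mathbf{u}}))$ by setting $U=\mathbf 1 v^0+i\sum_{k=1}^3\tilde\sigma_k v^k$ where $\tilde\sigma_k=\sigma_k e^{i\varphi_k}$. Furthermore one has $\mathrm{ch}_{\frac12}(U)=0$.
   Context: $C_{\mathrm{alg}}(\mathbb{R}^4_{\mathbf{u}})$ is the complex unital $*$-algebra generated by hermitian elements $x^0,\dots,x^3$ with relations $$\cos(\varphi_k)[x^0,x^k]_-=i\sin(\varphi_\ell-\varphi_m)[x^\ell,x^m]_+,\qquad \cos(\varphi_\ell-\varphi_m)[x^\ell,x^m]_-=-i\sin(\varphi_k)[x^0,x^k]_+$$ for every cyclic permutation $(k,\ell,m)$ of $(1,2,3)$, $[x,y]_\pm=xy\pm yx$. $C_{\mathrm{alg}}(S^3_{\mathbf{u}})$ is its quotient by the two-sided ideal generated by $\sum_{\mu=0}^3(x^\mu)^2-\mathbf 1$, and $v^\mu$ denotes the image of $x^\mu$ in it. $C_{\mathrm{alg}}(\mathbb{R}^5_{\mathbf{u}})$ is obtained from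 $C_{\mathrm{alg}}(\mathbb{R}^4_{\mathbf{u}})$ by adding a central hermitian generator $x^4$; $C_{\mathrm{alg}}(S^4_{\mathbf{u}})$ is the quotient of $C_{\mathrm{alg}}(\mathbb{R}^5_{\mathbf{u}})$ by the two-sided ideal generated by $\sum_{\mu=0}^3(x^\mu)^2+(x^4)^2-\mathbf 1$, and $u^\mu$, $u$ denote the images of $x^\mu$ ($0\le\mu\le3$), $x^4$ in it. $\sigma_1,\sigma_2,\sigma_3\in M_2(\mathbb C)$ are the Pauli matrices. $\gamma_\mu=\gamma_\mu^*\in M_4(\mathbb{C})$ ($\mu=0,\dots,3$) satisfy $\gamma_\mu\gamma_\nu+\gamma_\nu\gamma_\mu=2\delta_{\mu\nu}\mathbf 1$, $\gamma=\gamma_0\gamma_1\gamma_2\gamma_3$, $\tilde\gamma_0=\gamma_0$ and $\tilde\gamma_k=e^{\frac i2\varphi_k\gamma}\gamma_k e^{-\frac i2\varphi_k\gamma}$ for $k=1,2,3$. Chern character components. For an idempotent $e\in M_q(\mathcal A)$, with $\tilde{\mathcal A}=\mathcal A/\mathbb{C}1$ (quotient vector space), $\mathrm{ch}_k(e)=\sum\big(e^{i_0}_{i_1}-\frac12\delta^{i_0}_{i_1}\big)\otimes e^{i_1}_{i_2}\otimes\cdots\otimes e^{i_{2k}}_{i_0}\in\mathcal A\otimes\tilde{\mathcal A}^{\otimes 2k}$ (so $\mathrm{ch}_0(e)=\sum_i(e^i_i-\frac12)\in\mathcal A$). For a unitary $U\in M_q(\mathcal{A})$, $\mathrm{ch}_{\frac12}(U)=\sum\big(U^i_j\otimes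 (U^* )^j_i-(U^* )^i_j\otimes U^j_i\big)$, viewed in $\mathcal{A}\otimes\mathcal{A}$. *)

(* Defs.v *)
From HB Require Import structures.
From mathcomp Require Import all_boot all_order all_algebra.
From mathcomp Require Import all_classical all_reals all_analysis.
From mathcomp Require Import finmap complex.
(* The notations of monalg are incompatible with those of mathcomp-analysis. *)
From mathcomp Require monalg.
Import -(notations) monalg.

Set Implicit Arguments.
Unset Strict Implicit.
Unset Printing Implicit Defensive.

Import Order.TTheory GRing.Theory Num.Theory.
Import numFieldNormedType.Exports.

Local Open Scope classical_set_scope.
Local Open Scope ring_scope.
Local Open Scope quotient_scope.

Section LinearQuotient.
Variables (K : pzRingType) (V : lmodType K) (S : set V).

Inductive lspan : V -> Prop :=
| lspan_gen v of S v : lspan v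
| lspan0 : lspan 0
| lspanD u v of lspan u & lspan v : lspan (u + v)
| lspanZ c v of lspan v : lspan (c *: v).

Lemma lspanN v : lspan v -> lspan (- v).
Proof. by move=> Sv; rewrite -scaleN1r; apply: lspanZ. Qed.

Lemma lspanB u v : lspan u -> lspan v -> lspan (u - v).
Proof. by move=> Su Sv; apply: lspanD => //; apply: lspanN. Qed.

Definition lquot_rel : rel V := fun u v => `[< lspan (u - v) >].

Fact lquot_refl : reflexive lquot_rel.
Proof. by move=> u; apply/asboolP; rewrite subrr; apply: lspan0. Qed.

Fact lquot_sym : symmetric lquot_rel.
Proof.
by move=> u v; apply/asboolP/asboolP => /lspanN; rewrite opprB.
Qed.

Fact lquot_trans : transitive lquot_rel.
Proof.
move=> v u w /asboolP uv /asboolP vw; apply/asboolP.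
by have := lspanD uv vw; rewrite addrA subrK.
Qed.

Canonical lquot_equiv := EquivRel lquot_rel lquot_refl lquot_sym lquot_trans.

Definition lquot := {eq_quot lquot_equiv}.

HB.instance Definition _ := Choice.on lquot.
HB.instance Definition _ := EqQuotient.on lquot.

Definition lpi (v : V) : lquot := \pi_lquot v.

Lemma lpiP u v : lpi u = lpi v <-> lspan (u - v).
Proof.
by rewrite /lpi; split=> [/eqmodP/asboolP|?] //; apply/eqmodP/asboolP.
Qed.

Lemma lpi_surj (x : lquot) : exists v, x = lpi v.
Proof. by exists (repr x); rewrite /lpi reprK. Qed.

Lemma lquot_eq (u v : V) : lspan (u - v) -> lpi u = lpi v.
Proof. by move/lpiP. Qed.

Lemma repr_lpi v : lspan (repr (lpi v) - v).
Proof. by apply/lpiP; rewrite /lpi reprK. Qed.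

Definition lquot_add (x y : lquot) := lpi (repr x + repr y).
Definition lquot_opp (x : lquot) := lpi (- repr x).
Definition lquot_scale (c : K) (x : lquot) := lpi (c *: repr x).

Fact lquot_addE u v : lquot_add (lpi u) (lpi v) = lpi (u + v).
Proof.
by apply: lquot_eq; rewrite opprD addrACA; apply: lspanD; apply: repr_lpi.
Qed.

Fact lquot_oppE u : lquot_opp (lpi u) = lpi (- u).
Proof. by apply: lquot_eq; rewrite -opprD; apply: lspanN; apply: repr_lpi. Qed.

Fact lquot_scaleE c u : lquot_scale c (lpi u) = lpi (c *: u).
Proof.
by apply: lquot_eq; rewrite -scalerBr; apply: lspanZ; apply: repr_lpi.
Qed.

Fact lquot_addA : associative lquot_add.
Proof.
move=> x y z; have [u ->] := lpi_surj x; have [v ->] := lpi_surj y.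
by have [w ->] := lpi_surj z; rewrite !lquot_addE addrA.
Qed.

Fact lquot_addC : commutative lquot_add.
Proof. by move=> x y; rewrite /lquot_add addrC. Qed.

Fact lquot_add0 : left_id (lpi 0) lquot_add.
Proof. by move=> x; have [u ->] := lpi_surj x; rewrite lquot_addE add0r. Qed.

Fact lquot_addN : left_inverse (lpi 0) lquot_opp lquot_add.
Proof.
by move=> x; have [u ->] := lpi_surj x; rewrite lquot_oppE lquot_addE addNr.
Qed.

HB.instance Definition _ := GRing.isZmodule.Build lquot
  lquot_addA lquot_addC lquot_add0 lquot_addN.

Fact lquot_scaleA a b x :
  lquot_scale a (lquot_scale b x) = lquot_scale (a * b) x.
Proof. by have [u ->] := lpi_surj x; rewrite !lquot_scaleE scalerA. Qed.

Fact lquot_scale1 : left_id 1 lquot_scale.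
Proof.
by move=> x; have [u ->] := lpi_surj x; rewrite lquot_scaleE scale1r.
Qed.

Fact lquot_scaleDr : right_distributive lquot_scale +%R.
Proof.
move=> a x y; have [u ->] := lpi_surj x; have [v ->] := lpi_surj y.
rewrite -[lpi u + lpi v]/(lquot_add _ _) lquot_addE !lquot_scaleE scalerDr.
by rewrite -lquot_addE.
Qed.

Fact lquot_scaleDl x : {morph lquot_scale^~ x : a b / a + b}.
Proof.
move=> a b; have [u ->] := lpi_surj x.
by rewrite !lquot_scaleE scalerDl -lquot_addE.
Qed.

HB.instance Definition _ := GRing.Zmodule_isLmodule.Build K lquot
  lquot_scaleA lquot_scale1 lquot_scaleDr lquot_scaleDl.

Fact lpi_is_linear : linear lpi.
Proof.
move=> a u v; rewrite -lquot_addE -lquot_scaleE.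
by [].
Qed.

HB.instance Definition _ :=
  GRing.isLinear.Build K V lquot *:%R lpi lpi_is_linear.

End LinearQuotient.

Section Tensor.
Variables (K : fieldType) (V W : lmodType K).

Local Notation basis v w := (mkmalgU (v, w) 1 : malg (V * W)%type K).

Inductive bilin_rel : set (malg (V * W)%type K) :=
| bilin_Dl u v w : bilin_rel (basis (u + v) w - basis u w - basis v w)
| bilin_Dr v w z : bilin_rel (basis v (w + z) - basis v w - basis v z)
| bilin_Zl c v w : bilin_rel (basis (c *: v) w - c *: basis v w)
| bilin_Zr c v w : bilin_rel (basis v (c *: w) - c *: basis v w).

Definition tensor : lmodType K := lquot bilin_rel.

Definition tens (v : V) (w : W) : tensor := lpi bilin_rel (basis v w).

End Tensor.

HB.mixin Record isStarAlgebra (R : realType) A of GRing.Algebra R[i] A := {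
  star : A -> A;
  starD : {morph star : x y / x + y};
  starZ : forall (c : R[i]) (x : A), star (c *: x) = c^* *: star x;
  starM : forall x y : A, star (x * y) = star y * star x;
  starK : involutive star
}.

#[short(type="starAlgType")]
HB.structure Definition StarAlgebra (R : realType) :=
  {A of GRing.Algebra R[i] A & isStarAlgebra R A}.

Section StarAlgebraTheory.
Variables (R : realType) (A : starAlgType R).

Lemma star0 : star (0 : A) = 0.
Proof. by apply: (addrI (star (0 : A))); rewrite -starD !addr0. Qed.

Lemma starN : {morph star : x / - x :> A}.
Proof. by move=> x; apply: (addrI (star x)); rewrite -starD !subrr star0. Qed.

Lemma starB : {morph star : x y / x - y :> A}.
Proof. by move=> x y; rewrite starD starN. Qed.

Lemma star1 : star (1 : A) = 1.
Proof. by rewrite -[LHS]mulr1 -{2}[1]starK -starM mulr1 starK. Qed.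

Lemma star_sum (I : Type) (r : seq I) (P : pred I) (F : I -> A) :
  star (\sum_(i <- r | P i) F i) = \sum_(i <- r | P i) star (F i).
Proof. exact: (big_morph _ starD star0). Qed.

Definition self_adjoint (x : A) := star x = x.

Definition comm_minus (x y : A) : A := x * y - y * x.
Definition comm_plus (x y : A) : A := x * y + y * x.

Lemma star_comm_minus x y : self_adjoint x -> self_adjoint y ->
  star (comm_minus x y) = - comm_minus x y.
Proof. by move=> hx hy; rewrite starB !starM hx hy opprB. Qed.

Lemma star_comm_plus x y : self_adjoint x -> self_adjoint y ->
  star (comm_plus x y) = comm_plus x y.
Proof. by move=> hx hy; rewrite starD !starM hx hy addrC. Qed.

End StarAlgebraTheory.

(* The two-sided ideal generated by S is the linear span of the a s b. *)

Section StarQuotient.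
Variables (R : realType) (A : starAlgType R).

Definition two_sided (S : set A) : set A :=
  [set x | exists a s b, S s /\ x = a * s * b].

Definition ideal (S : set A) : set A := lspan (two_sided S).

Lemma ideal_gen (S : set A) s : S s -> ideal S s.
Proof.
by move=> Ss; apply: lspan_gen; exists 1, s, 1; rewrite mul1r mulr1.
Qed.

Lemma idealMl (S : set A) a x : ideal S x -> ideal S (a * x).
Proof.
elim=> [_ [b [s [c [Ss ->]]]]||u v _ IHu _ IHv|c v _ IHv].
- by apply: lspan_gen; exists (a * b), s, c; rewrite !mulrA.
- by rewrite mulr0; apply: lspan0.
- by rewrite mulrDr; apply: lspanD.
- by rewrite -scalerAr; apply: lspanZ.
Qed.

Lemma idealMr (S : set A) a x : ideal S x -> ideal S (x * a).
Proof.
elim=> [_ [b [s [c [Ss ->]]]]||u v _ IHu _ IHv|c v _ IHv].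
- by apply: lspan_gen; exists b, s, (c * a); rewrite !mulrA.
- by rewrite mul0r; apply: lspan0.
- by rewrite mulrDl; apply: lspanD.
- by rewrite -scalerAl; apply: lspanZ.
Qed.

Definition star_stable (S : set A) := forall s, S s -> ideal S (star s).

Lemma ideal_star (S : set A) x : star_stable S -> ideal S x -> ideal S (star x).
Proof.
move=> hS; elim=> [_ [b [s [c [Ss ->]]]]||u v _ IHu _ IHv|c v _ IHv].
- by rewrite !starM; apply: idealMl; apply: idealMr; apply: hS.
- by rewrite star0; apply: lspan0.
- by rewrite starD; apply: lspanD.
- by rewrite starZ; apply: lspanZ.
Qed.

(* The star descends to the quotient by the two-sided ideal generated by a
   star_stable set. Properness is required because the algebras of MathComp are
   nonzero by definition. *)
Record star_relations := StarRelations {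
  relators :> set A;
  relators_star : star_stable relators;
  relators_proper : ~ ideal relators 1
}.

Variable S : star_relations.

Definition squot := lquot (two_sided S).
Local Notation Q := squot.

HB.instance Definition _ := GRing.Lmodule.on Q.

Definition spi (x : A) : Q := lpi (two_sided S) x.

HB.instance Definition _ :=
  GRing.isLinear.Build R[i] A Q *:%R spi (@lpi_is_linear _ _ _).

Lemma spiP x y : spi x = spi y <-> ideal S (x - y).
Proof. exact: lpiP. Qed.

Lemma spiD : {morph spi : x y / x + y}.
Proof. exact: raddfD. Qed.

Lemma spiZ (c : R[i]) x : spi (c *: x) = c *: spi x.
Proof. exact: linearZ. Qed.

Lemma spi_surj (x : Q) : exists a, x = spi a.
Proof. exact: lpi_surj. Qed.

Definition squot_mul (x y : Q) : Q := spi (repr x * repr y).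
Definition squot_star (x : Q) : Q := spi (star (repr x)).

Fact squot_mulE x y : squot_mul (spi x) (spi y) = spi (x * y).
Proof.
apply/spiP; set x' := repr _; set y' := repr _.
have hx : ideal S (x' - x) by apply: repr_lpi.
have hy : ideal S (y' - y) by apply: repr_lpi.
have -> : x' * y' - x * y = x' * (y' - y) + (x' - x) * y.
  by rewrite mulrBr mulrBl addrA subrK.
by apply: lspanD; [apply: idealMl | apply: idealMr].
Qed.

Fact squot_starE x : squot_star (spi x) = spi (star x).
Proof.
apply/spiP; rewrite -starB.
by apply: ideal_star; [apply: relators_star|apply: repr_lpi].
Qed.

Fact squot_mulA : associative squot_mul.
Proof.
move=> x y z; have [u ->] := spi_surj x; have [v ->] := spi_surj y.
by have [w ->] := spi_surj z; rewrite !squot_mulE mulrA.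
Qed.

Fact squot_mul1 : left_id (spi 1) squot_mul.
Proof. by move=> x; have [u ->] := spi_surj x; rewrite squot_mulE mul1r. Qed.

Fact squot_mulr1 : right_id (spi 1) squot_mul.
Proof. by move=> x; have [u ->] := spi_surj x; rewrite squot_mulE mulr1. Qed.

Fact squot_mulDl : left_distributive squot_mul +%R.
Proof.
move=> x y z; have [u ->] := spi_surj x; have [v ->] := spi_surj y.
by have [w ->] := spi_surj z; rewrite -spiD !squot_mulE mulrDl spiD.
Qed.

Fact squot_mulDr : right_distributive squot_mul +%R.
Proof.
move=> x y z; have [u ->] := spi_surj x; have [v ->] := spi_surj y.
by have [w ->] := spi_surj z; rewrite -spiD !squot_mulE mulrDr spiD.
Qed.

Fact squot_1_neq0 : spi 1 != 0.
Proof.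
apply/eqP; rewrite -(raddf0 spi) => /spiP; rewrite subr0.
exact: relators_proper.
Qed.

HB.instance Definition _ := GRing.Zmodule_isNzRing.Build Q
  squot_mulA squot_mul1 squot_mulr1 squot_mulDl squot_mulDr squot_1_neq0.

Lemma spiM x y : spi (x * y) = spi x * spi y.
Proof. by rewrite [RHS]squot_mulE. Qed.

Lemma spi1 : spi 1 = 1.
Proof. by []. Qed.

Fact squot_scaleAl (c : R[i]) (x y : Q) : c *: (x * y) = (c *: x) * y.
Proof.
have [u ->] := spi_surj x; have [v ->] := spi_surj y.
by rewrite -spiZ -!spiM -spiZ scalerAl.
Qed.

Fact squot_scaleAr (c : R[i]) (x y : Q) : c *: (x * y) = x * (c *: y).
Proof.
have [u ->] := spi_surj x; have [v ->] := spi_surj y.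
by rewrite -spiZ -!spiM -spiZ scalerAr.
Qed.

HB.instance Definition _ := GRing.Lmodule_isLalgebra.Build R[i] Q squot_scaleAl.
HB.instance Definition _ := GRing.Lalgebra_isAlgebra.Build R[i] Q squot_scaleAr.

Fact squot_starD : {morph squot_star : x y / x + y}.
Proof.
move=> x y; have [u ->] := spi_surj x; have [v ->] := spi_surj y.
by rewrite -spiD !squot_starE starD spiD.
Qed.

Fact squot_starZ (c : R[i]) (x : Q) : squot_star (c *: x) = c^* *: squot_star x.
Proof.
by have [u ->] := spi_surj x; rewrite -spiZ !squot_starE starZ spiZ.
Qed.

Fact squot_starM (x y : Q) :
  squot_star (x * y) = squot_star y * squot_star x.
Proof.
have [u ->] := spi_surj x; have [v ->] := spi_surj y.
by rewrite -spiM !squot_starE starM spiM.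
Qed.

Fact squot_starK : involutive squot_star.
Proof. by move=> x; have [u ->] := spi_surj x; rewrite !squot_starE starK. Qed.

HB.instance Definition _ := isStarAlgebra.Build R Q
  squot_starD squot_starZ squot_starM squot_starK.

Lemma star_spi x : star (spi x) = spi (star x).
Proof. exact: squot_starE. Qed.

End StarQuotient.

(* The free complex unital *-algebra on n hermitian generators is the algebra of
   noncommutative polynomials, with the star that reverses words and conjugates
   coefficients. *)

Section NoncommutativePolynomials.
Variables (C : numClosedFieldType) (n : nat).

Local Notation ncpoly := (malg (fmonom 'I_n) C).

Definition fmrev (w : fmonom 'I_n) : fmonom 'I_n := FMonom (rev w).

Definition freestar (p : ncpoly) : ncpoly :=
  \sum_(w <- msupp p) mkmalgU (fmrev w) (mcoeff w p)^*.

Fact fmrevK : involutive fmrev.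
Proof. by case=> w; rewrite /fmrev /= revK. Qed.

Fact fmrevM v w : fmrev (mmul v w) = mmul (fmrev w) (fmrev v).
Proof. by rewrite /mmul /= !fmmulE /fmrev /= rev_cat. Qed.

Fact mcoeff_freestar w p : mcoeff w (freestar p) = (mcoeff (fmrev w) p)^*.
Proof.
rewrite [in RHS](monalgE p) /freestar !raddf_sum /=.
apply: eq_bigr => v _; rewrite !mcoeffU (inv_eq fmrevK).
by case: eqP => _; rewrite ?mulr1n ?mulr0n ?conjC0.
Qed.

Local Opaque freestar fgmul fgadd fgscale.

Fact freestarD : {morph freestar : p q / p + q}.
Proof.
move=> p q; apply/malgP => w; rewrite mcoeff_freestar [RHS]mcoeffD.
by rewrite !mcoeff_freestar -rmorphD -mcoeffD.
Qed.

Fact freestarZ (c : C) p : freestar (c *: p) = c^* *: freestar p.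
Proof.
apply/malgP => w; rewrite mcoeff_freestar [RHS]mcoeffZ.
by rewrite mcoeff_freestar -rmorphM -mcoeffZ.
Qed.

Fact freestarK : involutive freestar.
Proof.
by move=> p; apply/malgP => w; rewrite !mcoeff_freestar fmrevK conjCK.
Qed.

Fact freestarU w (c : C) : freestar (mkmalgU w c) = mkmalgU (fmrev w) c^*.
Proof.
apply/malgP => v; rewrite mcoeff_freestar !mcoeffU (inv_eq fmrevK).
by case: eqP => _; rewrite ?mulr1n ?mulr0n ?conjC0.
Qed.

Fact freestar_sum (I : Type) (r : seq I) (F : I -> ncpoly) :
  freestar (\sum_(i <- r) F i) = \sum_(i <- r) freestar (F i).
Proof.
apply: (big_morph _ freestarD).
by apply/malgP => w; rewrite mcoeff_freestar !mcoeff0 conjC0.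
Qed.

Fact ncpoly_mulUU v w (a b : C) :
  (mkmalgU v a : ncpoly) * (mkmalgU w b : ncpoly) = mkmalgU (mmul v w) (a * b).
Proof. exact: fgmulUU. Qed.

Fact freestarM p q : freestar (p * q) = freestar q * freestar p.
Proof.
rewrite (monalgE p) (monalgE q) [in LHS]mulr_suml !freestar_sum.
rewrite mulr_sumr; apply: eq_bigr => v _.
rewrite mulr_sumr freestar_sum mulr_suml; apply: eq_bigr => w _.
by rewrite ncpoly_mulUU !freestarU ncpoly_mulUU fmrevM rmorphM mulrC.
Qed.

Fact ncpoly_scaleAr (c : C) (p q : ncpoly) : c *: (p * q) = p * (c *: q).
Proof.
apply/malgP => u; rewrite mcoeffZ [in LHS]mcoeffMl.
rewrite (mcoeffMlw u (fsubset_refl _) (msuppZ_le c q)) mulr_sumr.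
apply: eq_bigr => v _; rewrite mulr_sumr; apply: eq_bigr => w _.
by rewrite mcoeffZ mulrnAr mulrCA.
Qed.

End NoncommutativePolynomials.

Section FreeStarAlgebra.
Variables (R : realType) (n : nat).

Definition freealg := malg (fmonom 'I_n) R[i].

HB.instance Definition _ := GRing.Lalgebra.on freealg.
HB.instance Definition _ :=
  GRing.Lalgebra_isAlgebra.Build R[i] freealg (@ncpoly_scaleAr R[i] n).
HB.instance Definition _ := isStarAlgebra.Build R freealg
  (@freestarD R[i] n) (@freestarZ R[i] n) (@freestarM R[i] n)
  (@freestarK R[i] n).

Definition freegen (i : 'I_n) : freealg := mkmalgU (fmu i) 1.

Lemma star_freegen i : self_adjoint (freegen i).
Proof.
rewrite /self_adjoint [LHS](@freestarU R[i]) conjC1 /freegen; congr mkmalgU.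
by rewrite fmuE /fmrev.
Qed.

End FreeStarAlgebra.

(* The character x^0 |-> 1, x^mu |-> 0 (mu > 0) shows that the algebras below
   are nonzero. *)

Section Characters.
Variables (R : realType).

Definition character (A : starAlgType R) (f : A -> R[i]) :=
  [/\ {morph f : x y / x + y}, forall c x, f (c *: x) = c * f x,
      {morph f : x y / x * y} & f 1 = 1].

Lemma character0 (A : starAlgType R) (f : A -> R[i]) : character f -> f 0 = 0.
Proof. by case=> _ fZ _ _; rewrite -(scale0r 0) fZ mul0r. Qed.

Lemma characterB (A : starAlgType R) (f : A -> R[i]) : character f ->
  {morph f : x y / x - y}.
Proof. by case=> fD fZ _ _ x y; rewrite fD -scaleN1r fZ mulN1r. Qed.

Lemma character_comm_minus (A : starAlgType R) (f : A -> R[i]) x y :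
  character f -> f (comm_minus x y) = 0.
Proof.
move=> chf; have [_ _ fM _] := chf.
by rewrite (characterB chf) !fM mulrC subrr.
Qed.

Lemma character_ideal (A : starAlgType R) (f : A -> R[i]) (S : set A) :
  character f -> (forall s, S s -> f s = 0) -> forall x, ideal S x -> f x = 0.
Proof.
move=> chf fS x; have f0 := character0 chf; have [fD fZ fM _] := chf.
elim=> [_ [a [s [b [Ss ->]]]]||u v _ fu _ fv|c v _ fv] //.
- by rewrite !fM (fS _ Ss) mulr0 mul0r.
- by rewrite fD fu fv addr0.
- by rewrite fZ fv mulr0.
Qed.

Lemma character_proper (A : starAlgType R) (f : A -> R[i]) (S : set A) :
  character f -> (forall s, S s -> f s = 0) -> ~ ideal S 1.
Proof.
move=> chf fS /(character_ideal chf fS); have [_ _ _ ->] := chf.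
by move/eqP; rewrite oner_eq0.
Qed.

Lemma character_squot (A : starAlgType R) (f : A -> R[i])
    (S : star_relations A) :
  character f -> (forall s, relators S s -> f s = 0) ->
  exists2 g : squot S -> R[i], character g & forall x, g (spi S x) = f x.
Proof.
move=> chf fS; have [fD fZ fM f1] := chf.
have gE x : f (repr (spi S x)) = f x.
  apply/eqP; rewrite -subr_eq0 -(characterB chf); apply/eqP.
  by apply: (character_ideal chf fS); apply: repr_lpi.
exists (fun x => f (repr x)) => //.
split=> [x y|c x|x y|]; last by rewrite -spi1 gE.
- have [u ->] := spi_surj x; have [v ->] := spi_surj y.
  by rewrite -spiD !gE fD.
- by have [u ->] := spi_surj x; rewrite -spiZ !gE fZ.
- have [u ->] := spi_surj x; have [v ->] := spi_surj y.
  by rewrite -spiM !gE fM.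
Qed.

Section Eval.
Variables (n : nat) (h : 'I_n -> R[i]).

Definition eval_word (w : fmonom 'I_n) : R[i] := \prod_(i <- w) h i.

Fact eval_word_mmorphism : mmorphism eval_word.
Proof.
split=> [v w|]; rewrite /eval_word; last by rewrite fm1 big_nil.
by rewrite /mmul /= fmmulE big_cat.
Qed.

HB.instance Definition _ := isMultiplicative.Build (fmonom 'I_n) R[i]
  eval_word eval_word_mmorphism.

Definition eval_free : freealg R n -> R[i] := mmap idfun eval_word.

Lemma eval_free_character : character eval_free.
Proof.
split=> [p q|c p|p q|]; first exact: mmapD.
- exact: mmapZ.
- have [+ _] := @mmap_is_multiplicative (fmonom 'I_n) R[i] R[i] idfun eval_word.
  exact.
- exact: mmap1.
Qed.

Lemma eval_freegen i : eval_free (freegen R i) = h i.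
Proof.
by rewrite /eval_free mmapU mul1r /eval_word fmuE big_seq1.
Qed.

End Eval.
End Characters.

(* The spatial indices 1, 2, 3 are represented by 'I_3, shifted by one: the
   generators are x^0 = x ord0 and x^{k+1} = x (lift ord0 k), the angle
   phi_{k+1} is phi k, and the cyclic permutations of (1, 2, 3) are the triples
   (k, ordS k, ordS (ordS k)). The components of u are e^{i phi_k}. *)

Section Relations.
Variables (R : realType) (phi : 'I_3 -> R).

Local Notation "'i" := ('i%C : R[i]).
Local Notation "t %:C" := (real_complex R t).

Section Generic.
Variables (A : starAlgType R) (x : 'I_4 -> A).

Let x0 := x ord0.
Let xs k := x (lift ord0 k).
Let l (k : 'I_3) := ordS k.
Let m (k : 'I_3) := ordS (ordS k).

Definition relation1 (k : 'I_3) : A :=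
  (cos (phi k))%:C *: comm_minus x0 (xs k)
  - ('i * (sin (phi (l k) - phi (m k)))%:C) *: comm_plus (xs (l k)) (xs (m k)).

Definition relation2 (k : 'I_3) : A :=
  (cos (phi (l k) - phi (m k)))%:C *: comm_minus (xs (l k)) (xs (m k))
  + ('i * (sin (phi k))%:C) *: comm_plus x0 (xs k).

Definition R4_relators : set A :=
  [set r | exists k, r = relation1 k \/ r = relation2 k].

Definition sum_squares : A := \sum_mu x mu ^+ 2.

Hypothesis x_herm : forall mu, self_adjoint (x mu).

Let conj_real (t : R) : t%:C^* = t%:C.
Proof. exact: conjc_real. Qed.

Let conj_imag (t : R) : ('i * t%:C)^* = - ('i * t%:C).
Proof.
rewrite rmorphM /= conj_real -mulNr; congr (_ * _).
by apply/eqP; rewrite eq_complex /= !oppr0 !eqxx.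
Qed.

Lemma R4_relators_star : star_stable R4_relators.
Proof.
move=> r [k relr].
suff -> : star r = (-1) *: r by apply: lspanZ; apply: ideal_gen; exists k.
rewrite scaleN1r; case: relr => ->.
- rewrite starB !starZ conj_real conj_imag star_comm_minus ?star_comm_plus //;
    try exact: x_herm.
  by rewrite scalerN scaleNr opprB opprK addrC.
- rewrite starD !starZ conj_real conj_imag star_comm_minus ?star_comm_plus //;
    try exact: x_herm.
  by rewrite scalerN scaleNr opprD.
Qed.

Lemma star_sum_squares : star sum_squares = sum_squares.
Proof.
by rewrite star_sum; apply: eq_bigr => mu _; rewrite expr2 starM x_herm.
Qed.

Variable f : A -> R[i].
Hypotheses (chf : character f) (f0 : f (x ord0) = 1)
  (fk : forall k, f (x (lift ord0 k)) = 0).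

Lemma R4_relators_char r : R4_relators r -> f r = 0.
Proof.
have [fD fZ fM f1] := chf; have fB := characterB chf.
case=> k [] ->; rewrite /relation1 /relation2 /comm_minus /comm_plus /xs /x0.
  by rewrite fB !fZ fB fD !fM !fk !(mulr0, mul0r, subrr, addr0).
by rewrite fD !fZ fB fD !fM !fk !(mulr0, mul0r, subrr, addr0).
Qed.

Lemma sum_squares_char : f sum_squares = 1.
Proof.
have [fD fZ fM f1] := chf.
rewrite (big_morph _ fD (character0 chf)) big_ord_recl expr2 fM f0 mulr1.
by rewrite big1 ?addr0 // => k _; rewrite expr2 fM fk mulr0.
Qed.

End Generic.

Definition R4_gen (mu : 'I_4) : freealg R 4 := freegen R mu.

Let h n (i : 'I_n) : R[i] := (val i == 0%N)%:R.

Fact R4_proper : ~ ideal (R4_relators R4_gen) 1.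
Proof.
apply: (@character_proper _ _ (eval_free (@h 4))).
  exact: eval_free_character.
apply: R4_relators_char => [|k]; first exact: eval_free_character.
by rewrite /R4_gen eval_freegen.
Qed.

Definition R4_relations : star_relations (freealg R 4) :=
  StarRelations (R4_relators_star (@star_freegen R 4)) R4_proper.

Definition R4 : starAlgType R := squot R4_relations.

Definition R4_x (mu : 'I_4) : R4 := spi R4_relations (R4_gen mu).

Fact R4_x_herm mu : self_adjoint (R4_x mu).
Proof. by rewrite /self_adjoint star_spi star_freegen. Qed.

Definition S3_relators : set R4 := [set sum_squares R4_x - 1].

Fact S3_star : star_stable S3_relators.
Proof.
move=> _ ->; rewrite starB star1 (star_sum_squares R4_x_herm).
exact: ideal_gen.
Qed.

Fact S3_proper : ~ ideal S3_relators 1.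
Proof.
have chf := eval_free_character (@h 4).
have [|g chg gE] := @character_squot _ _ _ R4_relations chf.
  by apply: R4_relators_char => // k; rewrite /R4_gen eval_freegen.
have [_ _ _ g1] := chg.
apply: (character_proper chg) => _ ->; rewrite (characterB chg) g1.
rewrite (sum_squares_char chg) ?subrr // => [|k]; rewrite gE eval_freegen //.
Qed.

Definition S3_relations : star_relations R4 :=
  StarRelations S3_star S3_proper.

Definition S3 : starAlgType R := squot S3_relations.

Definition S3_v (mu : 'I_4) : S3 := spi S3_relations (R4_x mu).

(* Presentation with one more hermitian generator x^4, of index ord_max, which
   commutes with the other ones, hence is central. *)

Definition R5_gen (mu : 'I_4) : freealg R 5 := freegen R (lift ord_max mu).
Definition R5_gen4 : freealg R 5 := freegen R ord_max.

Definition R5_relators : set (freealg R 5) :=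
  R4_relators R5_gen `|`
  [set r | exists mu, r = comm_minus R5_gen4 (R5_gen mu)].

Fact R5_star : star_stable R5_relators.
Proof.
have genS : ideal (R4_relators R5_gen) `<=` ideal R5_relators.
  move=> x; elim=> [_ [a [s [b [Ss ->]]]]||u v _ Iu _ Iv|c v _ Iv].
  - by apply: lspan_gen; exists a, s, b; split=> //; left.
  - exact: lspan0.
  - exact: lspanD.
  - exact: lspanZ.
move=> r [Sr|[mu ->]].
  by apply/genS/R4_relators_star => // mu; apply: star_freegen.
rewrite star_comm_minus; try exact: star_freegen.
by apply: lspanN; apply: ideal_gen; right; exists mu.
Qed.

Fact R5_relators_char r : R5_relators r -> eval_free (@h 5) r = 0.
Proof.
have chf := eval_free_character (@h 5); have [_ _ fM _] := chf.
case=> [|[mu ->]].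
  apply: R4_relators_char => // k.
  by rewrite /R5_gen eval_freegen; case: k => -[|[|[|]]].
exact: character_comm_minus.
Qed.

Fact R5_proper : ~ ideal R5_relators 1.
Proof.
apply: (character_proper (eval_free_character (@h 5))).
exact: R5_relators_char.
Qed.

Definition R5_relations : star_relations (freealg R 5) :=
  StarRelations R5_star R5_proper.

Definition R5 : starAlgType R := squot R5_relations.

Definition R5_x (mu : 'I_4) : R5 := spi R5_relations (R5_gen mu).
Definition R5_x4 : R5 := spi R5_relations R5_gen4.

Definition S4_relators : set R5 :=
  [set sum_squares R5_x + R5_x4 ^+ 2 - 1].

Fact S4_star : star_stable S4_relators.
Proof.
move=> _ ->; rewrite starB star1 starD star_sum_squares => [|mu].
  rewrite expr2 starM star_spi star_freegen -expr2; exact: ideal_gen.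
by rewrite /self_adjoint star_spi star_freegen.
Qed.

Fact S4_proper : ~ ideal S4_relators 1.
Proof.
have chf := eval_free_character (@h 5).
have [|g chg gE] := @character_squot _ _ _ R5_relations chf.
  exact: R5_relators_char.
have [gD _ gM _] := chg.
apply: (character_proper chg) => _ ->; rewrite (characterB chg) gD expr2 gM.
rewrite (sum_squares_char chg) => [||k]; rewrite ?gE ?eval_freegen //.
  by have [_ _ _ ->] := chf; rewrite mulr0 addr0 subrr.
by case: k => -[|[|[|]]].
Qed.

Definition S4_relations : star_relations R5 :=
  StarRelations S4_star S4_proper.

Definition S4 : starAlgType R := squot S4_relations.

Definition S4_u (mu : 'I_4) : S4 := spi S4_relations (R5_x mu).
Definition S4_u4 : S4 := spi S4_relations R5_x4.

End Relations.

Section StarMatrices.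
Variables (R : realType) (A : starAlgType R) (n : nat).

Definition mxstar (M : 'M[A]_n) : 'M[A]_n := \matrix_(i, j) star (M j i).

(* The element M (x) a of M_n(C) (x) A = M_n(A). *)
Definition mxtens (M : 'M[R[i]]_n) (a : A) : 'M[A]_n :=
  \matrix_(i, j) (M i j *: a).

End StarMatrices.

Section Chern.
Variables (R : realType) (A : starAlgType R).

Definition reduced : lmodType R[i] := lquot [set (1 : A)].

(* A (x) reduced^{(x) n}, associated to the left *)
Fixpoint cochain (n : nat) : lmodType R[i] :=
  if n is n'.+1 then tensor (cochain n') reduced else A.

Fixpoint elementary (a : A) (s : nat -> A) (n : nat) : cochain n :=
  if n is n'.+1 then tens (elementary a s n') (lpi [set (1 : A)] (s n'))
  else a.

(* The entry e^i_j is e i j, and ordS is the cyclic successor on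
   'I_(2k + 1), so that i_{2k+1} = i_0. *)
Definition ch (k q : nat) (e : 'M[A]_q) : cochain k.*2 :=
  \sum_(i : {ffun 'I_(k.*2).+1 -> 'I_q})
    let entry (j : 'I_(k.*2).+1) := e (i j) (i (ordS j)) in
    elementary
      (entry ord0 - (2^-1 : R[i]) *: (i ord0 == i (ordS ord0))%:R)
      (fun j => entry (inord j.+1)) k.*2.

Definition ch_half (q : nat) (U : 'M[A]_q) : tensor A A :=
  \sum_(i < q) \sum_(j < q)
    (tens (U i j) (mxstar U j i) - tens (mxstar U i j) (U j i)).

End Chern.

Section Projections.
Variables (R : realType).

Local Notation "t %:C" := (real_complex R t).

(* mathcomp-analysis puts the topology of the norm on R[i]^o. *)
Definition expmx n (M : 'M[R[i]]_n) : 'M[R[i]]_n :=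
  limn (series (fun m => m`!%:R^-1 *: M ^+ m : 'M[R[i]^o]_n)).

Definition expi (t : R) : R[i] := (cos t +i* sin t)%C.

Definition clifford (gamma : 'I_4 -> 'M[R[i]]_4) : Prop :=
  (forall mu, map_mx Num.conj (gamma mu)^T = gamma mu) /\
  (forall mu nu, gamma mu *m gamma nu + gamma nu *m gamma mu
                 = (2 * (mu == nu)%:R)%:M).

Definition gamma5 (gamma : 'I_4 -> 'M[R[i]]_4) : 'M[R[i]]_4 :=
  \prod_(mu < 4) gamma mu.

Definition gamma_tilde (gamma : 'I_4 -> 'M[R[i]]_4) (phi : 'I_3 -> R)
    (mu : 'I_4) : 'M[R[i]]_4 :=
  if unlift ord0 mu is Some k then
    let c := ('i%C / 2 * (phi k)%:C : R[i]) in
    expmx (c *: gamma5 gamma) *m gamma mu *m expmx (- c *: gamma5 gamma)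
  else gamma mu.

Definition pauli (k : 'I_3) : 'M[R[i]]_2 :=
  \matrix_(a, b)
    nth 0 (nth [::] [:: [:: 0;   1;        1;     0];
                        [:: 0;   - 'i%C;   'i%C;  0];
                        [:: 1;   0;        0;     -1]] k) (2 * a + b)%N.

Definition sigma_tilde (phi : 'I_3 -> R) (k : 'I_3) : 'M[R[i]]_2 :=
  expi (phi k) *: pauli k.

End Projections.

(* Main.v *)
(* Write gt_mu, u_mu for the twisted gamma matrices and the generators of S^4_u,
   and g for gamma. Since g^2 = 1, exp(i t g) = cos t + i (sin t) g, so that
   gt_k = exp(i phi_k g) gamma_k. In a product
   (sum_mu T_mu (x) x^mu) (sum_nu T'_nu (x) x^nu) with T_mu T'_mu = 1, the terms
   mu <> nu are grouped by k: x^0 x^k, x^k x^0, x^l x^m and x^m x^l. Both for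
   (T, T') = (gt, gt) and for the coefficients of U and U^*, the four matrix
   coefficients are such that the group is B_k (x) r_k + C_k (x) s_k, where r_k
   and s_k are the two defining relators; only sum_mu (x^mu)^2 survives. The
   Chern characters are sums of tensors weighted by tr(T_a), tr(T_a T_b T_c) and
   tr(T_a T'_b) - tr(T'_a T_b). The first two vanish because the matrices, or
   the B_k and C_k, anticommute with an involution, the last one because
   tr B_k = tr C_k = 0. *)

Require Import Defs.
From HB Require Import structures.
From mathcomp Require Import all_boot all_order all_algebra.
From mathcomp Require Import all_classical all_reals all_analysis.
From mathcomp Require Import finmap complex ring.
From mathcomp Require monalg.

Set Implicit Arguments.
Unset Strict Implicit.
Unset Printing Implicit Defensive.

Import GRing.Theory Num.Theory.
Local Open Scope ring_scope.

(** * Exponential of a complex multiple of an involution *)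

Section Exponential.
Import numFieldNormedType.Exports.
Variables (R : realType) (n : nat).
Local Notation "t %:C" := (real_complex R t).

Lemma cvg_real_complex (u : nat -> R) (l : R) :
  (u @ \oo --> l)%classic ->
  ((fun m => (u m)%:C : R[i]^o) @ \oo --> (l%:C : R[i]^o))%classic.
Proof.
move=> /cvgrPdist_lt ul; apply/cvgrPdist_lt => -[e e'].
(* A positive radius in [R[i]] has zero imaginary part, so it is a real epsilon. *)
rewrite ltcE => /andP[/= /eqP -> e_gt0]; near=> m.
rewrite -rmorphB -[Num.norm _]/(`|(l - u m)%:C|) normc_def /= expr0n addr0.
by rewrite sqrtr_sqr ltcR; near: m; exact: ul.
Unshelve. all: by end_near. Qed.

(** Since [g] squares to 1, [g ^+ m] depends only on the parity of [m]: even terms feed the cosine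
    series and odd terms ['i] times the sine series. *)
Lemma exp_term_involution (g : 'M[R[i]]_n.+1) (t : R) m : g ^+ 2 = 1 ->
  m`!%:R^-1 *: (('i%C * t%:C) *: g) ^+ m
  = (cos_coeff t m)%:C *: 1 + ('i%C * (sin_coeff t m)%:C) *: g.
Proof.
move=> gg.
rewrite exprZn exprMn scalerA -[m in g ^+ m]odd_double_half exprD.
rewrite -mul2n exprM gg expr1n mulr1 -[in 'i%C ^+ m](odd_double_half m) exprD.
rewrite -mul2n exprM sqr_i /cos_coeff /sin_coeff /=.
rewrite !rmorphM /= fmorphV /= !rmorphXn /= rmorphN1 !rmorph_nat.
(* The exponent [m.-1./2] of [sin_coeff] agrees with [m./2] for odd [m]; for even [m] the factor
   [odd m] makes both sides zero. *)
have -> : (odd m)%:R * (-1) ^+ m.-1./2 = (odd m)%:R * (-1) ^+ m./2 :> R[i].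
  by case: m => //= m; case: (boolP (odd m)) => om; rewrite ?mul0r //
    uphalf_half (negbTE om).
case: (odd m); rewrite ?(expr0, expr1, mul0r, mulr0, scale0r, addr0, add0r) /=;
  congr (_ *: _); ring.
Qed.

Lemma expmx_involution (g : 'M[R[i]]_n.+1) (t : R) : g ^+ 2 = 1 ->
  expmx (('i%C * t%:C) *: g) = (cos t)%:C *: 1 + ('i%C * (sin t)%:C) *: g.
Proof.
move=> gg; rewrite /expmx; apply: (@cvg_lim 'M[R[i]^o]_n.+1).
  exact: norm_hausdorff.
have cosP : (series (cos_coeff t) @ \oo --> cos t)%classic.
  rewrite unlock; exact: is_cvg_series_cos_coeff.
have sinP : (series (sin_coeff t) @ \oo --> sin t)%classic.
  rewrite unlock; exact: is_cvg_series_sin_coeff.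
(* The partial sums are those of cosine and sine times the constant matrices [1] and ['i *: g], so
   two scalar limits suffice. *)
rewrite (_ : series _ = fun m =>
    ((series (cos_coeff t) m)%:C : R[i]^o) *: (1 : 'M[R[i]^o]_n.+1)
    + ((series (sin_coeff t) m)%:C : R[i]^o) *: ('i%C *: g : 'M[R[i]^o]_n.+1));
  last first.
  apply/funext => m; rewrite /series /= !rmorph_sum !scaler_suml -big_split /=.
  apply: eq_bigr => k _.
  by rewrite exp_term_involution // scalerA [_%:C * _]mulrC.
rewrite mulrC -scalerA.
by apply: (@cvgD _ 'M[R[i]^o]_n.+1); apply: cvgZr_tmp; apply: cvg_real_complex.
Qed.
End Exponential.

(** * Pairs of indices grouped along cyclic permutations *)

Section CyclicIndices.

Lemma ordS3K (k : 'I_3) : ordS (ordS (ordS k)) = k.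
Proof. by apply: val_inj; case: k => -[|[|[|]]]. Qed.

Lemma sum_ord3 (V : nmodType) (F : 'I_3 -> V) k :
  \sum_j F j = F k + F (ordS k) + F (ordS (ordS k)).
Proof.
rewrite (bigD1 k) //= (bigD1 (ordS k)) /=; last by case: k => -[|[|[|]]].
rewrite (bigD1 (ordS (ordS k))) /=; last by case: k => -[|[|[|]]].
rewrite big1 ?addr0 ?addrA // => j.
by case: k j => -[|[|[|//]]] ? [[|[|[|//]]] ?] //.
Qed.

(** Two distinct indices either include 0 or are both spatial; in the latter case they are [ordS k]
    and [ordS (ordS k)], in some order, for a unique [k]. This grouping matches the one in the
    defining relations. *)
Lemma sum_pairs_ord4 (V : nmodType) (F : 'I_4 -> 'I_4 -> V) :
  let s := lift ord0 in
  \sum_mu \sum_nu F mu nu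
  = \sum_mu F mu mu + \sum_k (F ord0 (s k) + F (s k) ord0
      + (F (s (ordS k)) (s (ordS (ordS k)))
         + F (s (ordS (ordS k))) (s (ordS k)))).
Proof.
move=> s; rewrite [LHS]big_ord_recl [X in X + _]big_ord_recl.
rewrite [X in _ = X + _]big_ord_recl -/s.
under [X in _ + _ + X = _]eq_bigr => k _.
  rewrite big_ord_recl (sum_ord3 (fun j => F (s k) (s j)) k) -/s.
  over.
rewrite !big_split /=.
have S_bij : bijective (@ordS 3).
  by exists (@ordS 3 \o @ordS 3) => k /=; rewrite ordS3K.
(* One shift takes the pairs [(k, k+1)] to [(k+1, k+2)]; below, two shifts take [(k, k+2)] to
   [(k+2, k+1)]. *)
have -> : \sum_(k < 3) F (s k) (s (ordS k))
  = \sum_(k < 3) F (s (ordS k)) (s (ordS (ordS k))).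
  by rewrite (reindex (@ordS 3)) //; exact: onW_bij.
have -> : \sum_(k < 3) F (s k) (s (ordS (ordS k)))
  = \sum_(k < 3) F (s (ordS (ordS k))) (s (ordS k)).
  rewrite (reindex (@ordS 3 \o @ordS 3)) /=; last exact/onW_bij/bij_comp.
  by apply: eq_bigr => k _; rewrite ordS3K.
by rewrite -!addrA; congr (_ + _); rewrite [X in _ + X = _]addrCA addrCA.
Qed.

Lemma pair_ord4P (P : 'I_4 -> 'I_4 -> Prop) :
  let s := lift ord0 in
  (forall mu, P mu mu) ->
  (forall k, P ord0 (s k)) -> (forall k, P (s k) ord0) ->
  (forall k, P (s (ordS k)) (s (ordS (ordS k)))) ->
  (forall k, P (s (ordS (ordS k))) (s (ordS k))) -> forall mu nu, P mu nu.
Proof.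
move=> s Pd P0 P1 P2 P3 mu nu.
case: (unliftP ord0 mu) => [k|] ->; case: (unliftP ord0 nu) => [j|] -> //.
have /or3P[/eqP->|/eqP->|/eqP->] // : [|| j == k, j == ordS k | k == ordS j].
  by case: k j => -[|[|[|//]]] ? [[|[|[|//]]] ?].
(* Three shifts being the identity, the pair [(k, ordS k)] is the one of [P2] at [ordS (ordS k)];
   the remaining case is [P3] at [ordS (ordS j)]. *)
- by rewrite -{1 2}(ordS3K k).
- by rewrite -{1 2}(ordS3K j).
Qed.

End CyclicIndices.

(** * Calculus of elementary tensors in matrices over [A] *)

Section TensorMatrices.
Variables (R : realType) (A : starAlgType R) (n : nat).
Implicit Types (M N : 'M[R[i]]_n) (a b : A).

Lemma mxtens0 a : mxtens (0 : 'M[R[i]]_n) a = 0.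
Proof. by apply/matrixP => i j; rewrite !mxE scale0r. Qed.

Lemma mxtens1 a : mxtens (1%:M : 'M[R[i]]_n) a = a%:M.
Proof. by apply/matrixP => i j; rewrite !mxE scaler_nat. Qed.

Lemma mxtensDl M N a : mxtens (M + N) a = mxtens M a + mxtens N a.
Proof. by apply/matrixP => i j; rewrite !mxE scalerDl. Qed.

Lemma mxtensDr M a b : mxtens M (a + b) = mxtens M a + mxtens M b.
Proof. by apply/matrixP => i j; rewrite !mxE scalerDr. Qed.

Lemma mxtensZ (c : R[i]) M a : mxtens (c *: M) a = mxtens M (c *: a).
Proof. by apply/matrixP => i j; rewrite !mxE scalerA mulrC. Qed.

Lemma mxtensNr M a : mxtens M (- a) = - mxtens M a.
Proof. by apply/matrixP => i j; rewrite !mxE scalerN. Qed.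

Lemma mxtensM M N a b : mxtens M a *m mxtens N b = mxtens (M *m N) (a * b).
Proof.
apply/matrixP => i j; rewrite !mxE scaler_suml; apply: eq_bigr => k _.
by rewrite !mxE -scalerAl -scalerAr scalerA.
Qed.

Lemma mxstar_mxtens M a :
  mxstar (mxtens M a) = mxtens (map_mx Num.conj M^T) (star a).
Proof. by apply/matrixP => i j; rewrite !mxE starZ. Qed.

Lemma mxstarD (X Y : 'M[A]_n) : mxstar (X + Y) = mxstar X + mxstar Y.
Proof. by apply/matrixP => i j; rewrite !mxE starD. Qed.

Lemma mxstar_sum (I : finType) (F : I -> 'M[A]_n) :
  mxstar (\sum_i F i) = \sum_i mxstar (F i).
Proof.
apply/matrixP => i j; rewrite !mxE !summxE star_sum.
by apply: eq_bigr => k _; rewrite mxE.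
Qed.

End TensorMatrices.

(** * Products of twisted sums modulo the defining relations *)

Section TwistedProduct.
Variables (R : realType) (phi : 'I_3 -> R) (n : nat).
Variables (T T' : 'I_4 -> 'M[R[i]]_n) (B C : 'I_3 -> 'M[R[i]]_n).
Local Notation s := (lift ord0).
Local Notation l k := (ordS k).
Local Notation m k := (ordS (ordS k)).
Local Notation "t %:C" := (real_complex R t).

(* The matrices B_k and C_k that multiply relation1 k and relation2 k in the
   product of \sum_mu T_mu x^mu and \sum_nu T'_nu x^nu. *)
Definition twisted_table :=
  [/\ forall mu, T mu *m T' mu = 1%:M,
      forall k, T ord0 *m T' (s k)
        = (cos (phi k))%:C *: B k + ('i%C * (sin (phi k))%:C) *: C k,
      forall k, T (s k) *m T' ord0
        = - (cos (phi k))%:C *: B k + ('i%C * (sin (phi k))%:C) *: C k,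
      forall k, T (s (l k)) *m T' (s (m k))
        = (cos (phi (l k) - phi (m k)))%:C *: C k
          - ('i%C * (sin (phi (l k) - phi (m k)))%:C) *: B k
    & forall k, T (s (m k)) *m T' (s (l k))
        = - (cos (phi (l k) - phi (m k)))%:C *: C k
          - ('i%C * (sin (phi (l k) - phi (m k)))%:C) *: B k].

Hypothesis tab : twisted_table.

Lemma twisted_product (A : starAlgType R) (x : 'I_4 -> A) :
  (forall k, relation1 phi x k = 0) -> (forall k, relation2 phi x k = 0) ->
  (\sum_mu mxtens (T mu) (x mu)) *m (\sum_mu mxtens (T' mu) (x mu))
  = (sum_squares x)%:M.
Proof.
move=> rel1 rel2; have [Td T0 T1 T2 T3] := tab.
rewrite mulmx_suml; under eq_bigr do rewrite mulmx_sumr.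
rewrite sum_pairs_ord4 /= [X in _ + X]big1 ?addr0 => [|k _].
  rewrite /sum_squares raddf_sum; apply: eq_bigr => mu _.
  by rewrite mxtensM Td mxtens1 expr2.
rewrite !mxtensM T0 T1 T2 T3.
have -> : 0
    = mxtens (B k) (relation1 phi x k) + mxtens (C k) (relation2 phi x k).
  by rewrite rel1 rel2; apply/matrixP => i j; rewrite !mxE !scaler0 addr0.
(* relation1 and relation2 contain the generic 'i of a numClosedFieldType. *)
rewrite /relation1 /relation2 /comm_minus /comm_plus -!complexiE.
rewrite !(scalerBr, scalerDr, mxtensDr, mxtensNr, mxtensDl) -!scaleNr !mxtensZ.
rewrite !scaleNr !mxtensNr !opprD.
(* Both sides consist of the same eight terms, which are made opaque and matched by a
   permutation. *)
move: (mxtens (B k) _) (mxtens (C k) _) (mxtens (B k) _) (mxtens (C k) _).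
move: (mxtens (C k) _) (mxtens (B k) _) (mxtens (C k) _) (mxtens (B k) _).
move=> c1 b1 c2 b2 b3 c3 b4 c4.
by rewrite [LHS](AC ((2*2)*(2*2)) ((1*3)*(6*8)*((5*7)*(2*4)))).
Qed.

(** Off the diagonal every product is a combination of some [B k] and [C k]. The weight [D] will be
    gamma for the projection and 1 for the unitary. *)
Lemma twisted_table_mxtrace (D : 'M[R[i]]_n) mu nu :
  (forall k, \tr (B k *m D) = 0) -> (forall k, \tr (C k *m D) = 0) ->
  mu != nu -> \tr (T mu *m T' nu *m D) = 0.
Proof.
have [_ T0 T1 T2 T3] := tab => trB trC; move: mu nu.
apply: pair_ord4P => [mu|k|k|k|k]; rewrite ?eqxx // => _;
  rewrite ?(T0, T1, T2, T3) ?mulmxDl ?mulmxBl -?scaleNr -!scalemxAl;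
  by rewrite mxtraceD !mxtraceZ trB trC !mulr0 addr0.
Qed.

End TwistedProduct.

(** * Words in four anticommuting involutions *)

Section CliffordWords.
Variables (V : nzRingType) (a b c d : V).
Hypotheses (aa : a * a = 1) (bb : b * b = 1) (cc : c * c = 1) (dd : d * d = 1).
Hypotheses (ba : b * a = - (a * b)) (ca : c * a = - (a * c))
  (da : d * a = - (a * d)) (cb : c * b = - (b * c)) (db : d * b = - (b * d))
  (dc : d * c = - (c * d)).
Local Notation w := (a * b * c * d).

(** Sorting the letters costs one sign per transposition, and equal neighbours cancel. Reversing
    four letters takes six transpositions, so the last identity carries no sign; it will make gamma
    hermitian. *)
Lemma clifford_words :
  [/\ w * w = 1, w * a = - (a * w), w * b = - (b * w),
     c * d = - (a * b * w) & d * c * b * a = w].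
Proof.
(* [sw] and [sq] are the sorting and cancelling rules behind a prefix [t], as they occur in
   left-associated words. *)
have sw (y z : V) (yz : y * z = - (z * y)) t : t * y * z = - (t * z * y).
  by rewrite -mulrA yz mulrN mulrA.
have sq (y : V) (yy : y * y = 1) t : t * y * y = t by rewrite -mulrA yy mulr1.
pose E := (mulrN, mulNr, mulrA, ba, ca, da, cb, db, dc, sw _ _ ba, sw _ _ ca,
  sw _ _ da, sw _ _ cb, sw _ _ db, sw _ _ dc, aa, bb, cc, dd, sq _ aa,
  sq _ bb, sq _ cc, sq _ dd, mul1r, opprK).
by split; rewrite !E.
Qed.
End CliffordWords.

(** * Gamma matrices and their twisted versions *)

Section Clifford.
Variables (R : realType) (gamma : 'I_4 -> 'M[R[i]]_4).
Hypothesis gamma_clifford : clifford gamma.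
Local Notation "t %:C" := (real_complex R t).
Local Notation s := (lift ord0).
Local Notation l k := (ordS k).
Local Notation m k := (ordS (ordS k)).
Local Notation g5 := (gamma5 gamma).

Lemma gamma_sqr mu : gamma mu * gamma mu = 1.
Proof.
have [_ /(_ mu mu)] := gamma_clifford.
rewrite eqxx mulr1 -mulr2n -scaler_nat -[2%:M]scalemx1 => /scalerI; apply.
by rewrite pnatr_eq0.
Qed.

Lemma gamma_anticomm mu nu :
  mu != nu -> gamma mu * gamma nu = - (gamma nu * gamma mu).
Proof.
move=> /negbTE mu_nu; apply/eqP; rewrite -subr_eq0 opprK; apply/eqP.
by have [_ /(_ mu nu)] := gamma_clifford; rewrite mu_nu mulr0 raddf0.
Qed.

(** A cyclic permutation of three anticommuting factors is even, so the product may start at any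
    spatial index. This allows a uniform treatment of [k]. *)
Lemma gamma5E k :
  g5 = gamma ord0 * gamma (s k) * gamma (s (l k)) * gamma (s (m k)).
Proof.
have rot (j : 'I_3) : gamma (s (l j)) * gamma (s (m j)) * gamma (s j)
    = gamma (s j) * gamma (s (l j)) * gamma (s (m j)).
  rewrite -mulrA (gamma_anticomm (mu := s (m j))).
    2: by case: j => -[|[|[|]]].
  rewrite mulrN mulrA (gamma_anticomm (mu := s (l j))).
    2: by case: j => -[|[|[|]]].
  by rewrite mulNr opprK.
pose P k := g5 = gamma ord0 * gamma (s k) * gamma (s (l k)) * gamma (s (m k)).
have P0 : P ord0.
  rewrite /P /gamma5 !big_ord_recl big_ord0 mulr1 !mulrA.
  by congr (_ * _ * gamma _ * gamma _); apply: val_inj.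
have PS j : P j -> P (l j).
  by rewrite /P ordS3K => ->; rewrite -!mulrA !(mulrA (gamma (s _))) rot.
have : [|| k == ord0, k == l ord0 | k == m ord0] by case: k => -[|[|[|]]].
by case/or3P => /eqP ->; [exact: P0 | exact: PS P0 | exact: PS (PS _ P0)].
Qed.

Lemma gamma5_words k :
  [/\ g5 * g5 = 1, g5 * gamma ord0 = - (gamma ord0 * g5),
      g5 * gamma (s k) = - (gamma (s k) * g5),
      gamma (s (l k)) * gamma (s (m k)) = - (gamma ord0 * gamma (s k) * g5)
    & gamma (s (m k)) * gamma (s (l k)) * gamma (s k) * gamma ord0 = g5].
Proof.
rewrite (gamma5E k); apply: clifford_words; rewrite ?gamma_sqr //;
  by apply: gamma_anticomm; case: k => -[|[|[|]]].
Qed.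

Lemma gamma5_sqr : g5 * g5 = 1.
Proof. by have [] := gamma5_words ord0. Qed.

Lemma gamma5_anticomm mu : g5 * gamma mu = - (gamma mu * g5).
Proof.
by case: (unliftP ord0 mu) => [k|] ->;
  [have [] := gamma5_words k | have [] := gamma5_words ord0].
Qed.

(** Closed form of exp(i t gamma). *)
Definition gamma5_rot (t : R) : 'M[R[i]]_4 :=
  (cos t)%:C *: 1 + ('i%C * (sin t)%:C) *: g5.

Lemma gamma5_rotD t u : gamma5_rot t * gamma5_rot u = gamma5_rot (t + u).
Proof.
rewrite /gamma5_rot cosD sinD rmorphB rmorphD !rmorphM /=.
rewrite mulrDl !mulrDr -!scalerAl -!scalerAr !mul1r mulr1 gamma5_sqr !scalerA.
rewrite ['i%C * _ * ('i%C * _)]mulrACA -expr2 sqr_i mulN1r.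
rewrite [LHS](AC (2*2) ((1*4)*(3*2))) /= !scalerDl.
by rewrite (mulrCA (cos t)%:C) -(mulrA 'i%C (sin t)%:C).
Qed.

Lemma gamma5_rot_comm (t : R) x :
  g5 * x = x * g5 -> gamma5_rot t * x = x * gamma5_rot t.
Proof.
by move=> gx; rewrite mulrDl mulrDr -!scalerAl -!scalerAr gx mul1r mulr1.
Qed.

Lemma gamma5_rot_anticomm (t : R) x :
  g5 * x = - (x * g5) -> gamma5_rot t * x = x * gamma5_rot (- t).
Proof.
move=> gx; rewrite /gamma5_rot cosN sinN rmorphN mulrN scaleNr.
by rewrite mulrDl mulrBr -!scalerAl -!scalerAr gx mul1r mulr1 scalerN.
Qed.

Lemma gamma5_rot0 : gamma5_rot 0 = 1.
Proof.
by rewrite /gamma5_rot cos0 sin0 rmorph0 mulr0 scale0r addr0 scale1r.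
Qed.

Lemma gamma_tilde0 (phi : 'I_3 -> R) : gamma_tilde gamma phi ord0 = gamma ord0.
Proof. by rewrite /gamma_tilde unlift_none. Qed.

(** Moving [gamma (s k)] across an exponential of gamma reverses the angle, so the two opposite
    half-angle factors combine into one of full angle on the left. *)
Lemma gamma_tildeS (phi : 'I_3 -> R) k :
  gamma_tilde gamma phi (s k) = gamma5_rot (phi k) * gamma (s k).
Proof.
rewrite /gamma_tilde liftK -!mulmxE.
have -> : ('i%C / 2 * (phi k)%:C : R[i]) = 'i%C * (phi k / 2)%:C.
  by rewrite rmorphM fmorphV rmorph_nat mulrAC mulrA.
rewrite -mulrN -rmorphN /= !expmx_involution ?expr2 ?gamma5_sqr //.
rewrite -[X in X *m _ *m _]/(gamma5_rot (phi k / 2)).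
rewrite -[X in _ *m X = _]/(gamma5_rot (- (phi k / 2))).
rewrite !mulmxE -mulrA -(gamma5_rot_anticomm _ (gamma5_anticomm _)) mulrA.
by rewrite gamma5_rotD -splitr.
Qed.

Lemma gamma_tilde_anticomm (phi : 'I_3 -> R) mu :
  g5 * gamma_tilde gamma phi mu = - (gamma_tilde gamma phi mu * g5).
Proof.
case: (unliftP ord0 mu) => [k|] ->; rewrite ?gamma_tilde0 ?gamma_tildeS.
  by rewrite mulrA -gamma5_rot_comm // -!mulrA gamma5_anticomm mulrN.
exact: gamma5_anticomm.
Qed.

Lemma gamma_tilde_sqr (phi : 'I_3 -> R) mu :
  gamma_tilde gamma phi mu * gamma_tilde gamma phi mu = 1.
Proof.
case: (unliftP ord0 mu) => [k|] ->; rewrite ?gamma_tilde0 ?gamma_tildeS.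
  rewrite {2}(gamma5_rot_anticomm _ (gamma5_anticomm _)) -mulrA.
  rewrite [X in _ * X = _]mulrA gamma_sqr mul1r gamma5_rotD subrr.
  exact: gamma5_rot0.
exact: gamma_sqr.
Qed.

Lemma gamma5_mul_comm x y :
  g5 * x = - (x * g5) -> g5 * y = - (y * g5) -> g5 * (x * y) = x * y * g5.
Proof.
by move=> gx gy; rewrite mulrA gx mulNr -(mulrA x g5) gy mulrN opprK mulrA.
Qed.

Lemma gamma5_pair_comm mu nu :
  g5 * (gamma mu * gamma nu) = gamma mu * gamma nu * g5.
Proof. by rewrite gamma5_mul_comm ?gamma5_anticomm. Qed.

(** Multiplication by gamma exchanges, up to sign, the pairs [(0, k)] and [(l, m)], that is, the
    matrices [B k] and [C k] of the table below. *)
Lemma gamma_pair_gamma5 k :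
  gamma (s (l k)) * gamma (s (m k)) * g5 = - (gamma ord0 * gamma (s k)).
Proof.
have [_ _ _ -> _] := gamma5_words k.
by rewrite mulNr -[X in - X = _]mulrA gamma5_sqr mulr1.
Qed.

Lemma gamma5_rot_pair mu nu t u :
  gamma5_rot t * gamma mu * (gamma5_rot u * gamma nu)
  = gamma mu * gamma nu * gamma5_rot (t - u).
Proof.
rewrite (gamma5_rot_anticomm u (gamma5_anticomm _)) mulrA.
rewrite -[gamma5_rot t * _ * _]mulrA.
rewrite (gamma5_rot_comm t (gamma5_pair_comm mu nu)).
by rewrite -[X in X = _]mulrA gamma5_rotD.
Qed.

(** Collecting the rotations on the right leaves, up to sign, a product of two gammas times a
    rotation by [phi k] or by [phi l - phi m]. The gamma component of that rotation turns the pair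
    into its dual pair. *)
Lemma gamma_tilde_table (phi : 'I_3 -> R) :
  twisted_table phi (gamma_tilde gamma phi) (gamma_tilde gamma phi)
    (fun k => gamma ord0 * gamma (s k))
    (fun k => gamma (s (l k)) * gamma (s (m k))).
Proof.
have rotN t : gamma5_rot (- t) = (cos t)%:C *: 1 - ('i%C * (sin t)%:C) *: g5.
  by rewrite /gamma5_rot cosN sinN rmorphN mulrN scaleNr.
split=> [mu|k|k|k|k]; rewrite ?mulmxE ?gamma_tilde0 ?gamma_tildeS.
- exact: gamma_tilde_sqr.
- have [_ _ _ -> _] := gamma5_words k.
  rewrite (gamma5_rot_anticomm _ (gamma5_anticomm _)) mulrA rotN mulrBr.
  by rewrite -!scalerAr mulr1 scalerN.
- have [_ _ _ -> _] := gamma5_words k.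
  rewrite -mulrA gamma_anticomm // mulrN gamma5_rot_comm ?gamma5_pair_comm //.
  by rewrite mulrDr -!scalerAr mulr1 opprD scalerN scaleNr.
- by rewrite gamma5_rot_pair mulrDr -!scalerAr mulr1 gamma_pair_gamma5 scalerN.
- rewrite gamma5_rot_pair gamma_anticomm; last by case: k => -[|[|[|]]].
  rewrite -(opprB (phi (l k))) rotN mulNr mulrBr -!scalerAr mulr1.
  by rewrite gamma_pair_gamma5 scalerN opprK opprD scaleNr.
Qed.

(** Conjugation by the involution [y] preserves the trace but sends [x] to [- x]. *)
Lemma mxtrace_anticomm n (x y : 'M[R[i]]_n.+1) :
  y * y = 1 -> y * x = - (x * y) -> \tr x = 0.
Proof.
move=> yy yx; have : \tr x = - \tr x.
  by rewrite -[in LHS](mul1r x) -yy -mulrA yx mulrN raddfN /= -mulmxE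
    mxtrace_mulC -mulmxA mulmxE yy mulr1.
by move/eqP; rewrite -addr_eq0 -mulr2n mulrn_eq0 /= => /eqP.
Qed.

Lemma mxtrace_gamma5 : \tr g5 = 0.
Proof.
by apply: (mxtrace_anticomm (gamma_sqr ord0)); rewrite gamma5_anticomm opprK.
Qed.

Lemma mxtrace_gamma5_odd x : g5 * x = - (x * g5) -> \tr x = 0.
Proof. exact: mxtrace_anticomm gamma5_sqr. Qed.

Lemma mxtrace_gamma_pair mu nu :
  mu != nu -> \tr (gamma mu * gamma nu) = 0.
Proof.
move=> mu_nu; apply: (mxtrace_anticomm (gamma_sqr mu)).
by rewrite [X in _ * X = _](gamma_anticomm mu_nu) mulrN mulrA.
Qed.

End Clifford.

(** * Adjoints and traces of the twisted gamma matrices *)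

Section CliffordStar.
Variables (R : realType) (gamma : 'I_4 -> 'M[R[i]]_4).
Hypothesis gamma_clifford : clifford gamma.
Local Notation "t %:C" := (real_complex R t).
Local Notation s := (lift ord0).
Local Notation g5 := (gamma5 gamma).
Local Notation "M ^H" := (map_mx Num.conj M^T) (at level 2, format "M ^H").

Lemma conjC_imag (t : R) : ('i%C * t%:C)^* = - ('i%C * t%:C).
Proof.
by apply/eqP; rewrite rmorphM eq_complex /=; apply/andP; split; apply/eqP; ring.
Qed.

Lemma mxadjM n (M N : 'M[R[i]]_n.+1) : (M * N)^H = N^H * M^H.
Proof. by rewrite -mulmxE trmx_mul map_mxM. Qed.

Lemma gamma_mxadj mu : (gamma mu)^H = gamma mu.
Proof. by have [-> _] := gamma_clifford. Qed.

Lemma gamma5_mxadj : g5^H = g5.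
Proof.
rewrite (gamma5E gamma_clifford ord0) !mxadjM !gamma_mxadj !mulrA.
by have [_ _ _ _ ->] := gamma5_words gamma_clifford ord0; apply: gamma5E.
Qed.

Lemma gamma5_rot_mxadj t : (gamma5_rot gamma t)^H = gamma5_rot gamma (- t).
Proof.
transitivity ((cos t)%:C^* *: 1^H + ('i%C * (sin t)%:C)^* *: g5^H).
  by rewrite -!map_mxZ -map_mxD /gamma5_rot linearD !linearZ.
rewrite conjC_imag gamma5_mxadj trmx1 map_mx1 /gamma5_rot cosN sinN.
by rewrite [_^*]conjc_real rmorphN /= mulrN.
Qed.

Lemma gamma_tilde_mxadj (phi : 'I_3 -> R) mu :
  (gamma_tilde gamma phi mu)^H = gamma_tilde gamma phi mu.
Proof.
case: (unliftP ord0 mu) => [k|] ->; last first.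
  by rewrite gamma_tilde0 gamma_mxadj.
rewrite (gamma_tildeS gamma_clifford) mxadjM gamma5_rot_mxadj gamma_mxadj.
by rewrite (gamma5_rot_anticomm _ (gamma5_anticomm gamma_clifford _)).
Qed.

(** The diagonal leaves the trace of gamma. Off the diagonal, the factor gamma exchanges [B k] and
    [C k] up to sign, and both are products of two distinct gammas, hence traceless. *)
Lemma mxtrace_gamma_tilde_gamma5 (phi : 'I_3 -> R) mu nu :
  \tr (gamma_tilde gamma phi mu * gamma_tilde gamma phi nu * g5) = 0.
Proof.
have [->|mu_nu] := eqVneq mu nu.
  by rewrite gamma_tilde_sqr // mul1r mxtrace_gamma5.
have tab := gamma_tilde_table gamma_clifford phi.
rewrite -!mulmxE; apply: (twisted_table_mxtrace tab) mu_nu => k.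
all: rewrite !mulmxE.
  have [_ _ _ /eqP + _] := gamma5_words gamma_clifford k.
  rewrite -eqr_oppLR => /eqP <-; rewrite raddfN /=.
  by rewrite mxtrace_gamma_pair ?oppr0 //; case: k => -[|[|[|]]].
by rewrite gamma_pair_gamma5 // raddfN /= mxtrace_gamma_pair ?oppr0.
Qed.

(* None stands for the index 4. *)
Definition gamma_tilde5 (phi : 'I_3 -> R) (a : option 'I_4) :=
  oapp (gamma_tilde gamma phi) g5 a.

Lemma mxtrace_gamma_tilde5 phi a : \tr (gamma_tilde5 phi a) = 0.
Proof.
case: a => [mu|] /=; last exact: mxtrace_gamma5.
exact: mxtrace_gamma5_odd (gamma_tilde_anticomm _ _ _).
Qed.

(** The cases count the factors equal to gamma. With none, the product anticommutes with gamma; with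
    one, cyclicity moves it to the end; with two or three, gamma squared being 1 leaves a single
    traceless factor. *)
Lemma mxtrace_gamma_tilde5_mul3 phi a b c :
  \tr (gamma_tilde5 phi a * gamma_tilde5 phi b * gamma_tilde5 phi c) = 0.
Proof.
have rot (x y z : 'M[R[i]]_4) : \tr (x * y * z) = \tr (z * x * y).
  by rewrite -mulmxE mxtrace_mulC mulmxA.
have pair := mxtrace_gamma_tilde_gamma5 phi.
have odd := gamma_tilde_anticomm gamma_clifford phi.
have g55 := gamma5_sqr gamma_clifford.
have tr1 := mxtrace_gamma_tilde5 phi.
case: a b c => [a|] [b|] [c|] /=.
- apply: (mxtrace_gamma5_odd gamma_clifford).
  by rewrite mulrA gamma5_mul_comm // -mulrA odd mulrN mulrA.
- exact: pair.
- by rewrite rot pair.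
- by rewrite -mulrA g55 mulr1 (tr1 (Some a)).
- by rewrite rot rot pair.
- by rewrite rot g55 mul1r (tr1 (Some b)).
- by rewrite g55 mul1r (tr1 (Some c)).
- by rewrite g55 mul1r (tr1 None).
Qed.

End CliffordStar.

(** * Bilinearity of tensors from the relators of the quotient *)

Section LinearQuotientRelations.
Variables (K : pzRingType) (V : lmodType K) (S : V -> Prop).

Lemma lpi_relD a b c : S (a - b - c) -> lpi S a = lpi S b + lpi S c.
Proof.
move=> Sabc; rewrite -linearD; apply: lquot_eq; rewrite opprD addrA.
exact: lspan_gen.
Qed.

Lemma lpi_relZ k a b : S (a - k *: b) -> lpi S a = k *: lpi S b.
Proof. by move=> Sab; rewrite -linearZ; apply: lquot_eq; apply: lspan_gen. Qed.

End LinearQuotientRelations.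

Section TensorSums.
Import -(notations) monalg.
Variables (K : fieldType) (V W : lmodType K).
Implicit Types (v : V) (w : W).
Local Notation M := (malg (V * W)%type K).

Lemma tensDl u v w : tens (u + v) w = tens u w + tens v w.
Proof. apply: (lpi_relD (V := M)). exact: bilin_Dl. Qed.

Lemma tensDr v w z : tens v (w + z) = tens v w + tens v z.
Proof. apply: (lpi_relD (V := M)). exact: bilin_Dr. Qed.

Lemma tensZl c v w : tens (c *: v) w = c *: tens v w.
Proof. apply: (lpi_relZ (V := M)). exact: bilin_Zl. Qed.

Lemma tensZr c v w : tens v (c *: w) = c *: tens v w.
Proof. apply: (lpi_relZ (V := M)). exact: bilin_Zr. Qed.

Lemma tens_sum (I J : finType) (F : I -> K) (G : J -> K)
    (v : I -> V) (w : J -> W) :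
  tens (\sum_i F i *: v i) (\sum_j G j *: w j)
  = \sum_i \sum_j (F i * G j) *: tens (v i) (w j).
Proof.
have t0l w0 : tens (0 : V) w0 = 0 by rewrite -(scale0r 0) tensZl scale0r.
have t0r v0 : tens v0 (0 : W) = 0 by rewrite -(scale0r 0) tensZr scale0r.
rewrite (big_morph (fun z : V => tens z _) (fun x y => tensDl x y _) (t0l _)).
apply: eq_bigr => i _.
rewrite (big_morph (fun z : W => tens _ z) (tensDr _) (t0r _)).
by apply: eq_bigr => j _; rewrite tensZl tensZr scalerA.
Qed.

End TensorSums.

(** * Chern character components as sums weighted by traces *)

Section ChernTraces.
Variables (R : realType) (A : starAlgType R) (q : nat) (I : finType).
Implicit Types (T : I -> 'M[R[i]]_q) (w : I -> A).

Lemma sum_mxtensE T w i j :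
  (\sum_a mxtens (T a) (w a)) i j = \sum_a T a i j *: w a.
Proof. by rewrite summxE; apply: eq_bigr => a _; rewrite mxE. Qed.

Lemma sum_ffun_ord1 (V : nmodType) (F : {ffun 'I_1 -> 'I_q} -> V) :
  \sum_f F f = \sum_i F [ffun=> i].
Proof.
rewrite (reindex (fun i : 'I_q => [ffun=> i])) //=.
apply: onW_bij; exists (fun f : {ffun _ -> _} => f ord0) => [i|f].
  by rewrite ffunE.
by apply/ffunP => j; rewrite ffunE (ord1 j).
Qed.

Lemma sum_ffun_ord3 (V : nmodType) (F : {ffun 'I_3 -> 'I_q} -> V) :
  \sum_f F f = \sum_i \sum_j \sum_k F [ffun n : 'I_3 => nth i [:: i; j; k] n].
Proof.
pose h (p : 'I_q * 'I_q * 'I_q) : {ffun 'I_3 -> 'I_q} :=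
  [ffun n : 'I_3 => nth p.1.1 [:: p.1.1; p.1.2; p.2] n].
have h_bij : bijective h.
  exists (fun f : {ffun _ -> _} =>
    (f ord0, f (ordS ord0), f (ordS (ordS ord0)))).
    by case=> -[i j] k; rewrite /h !ffunE.
  move=> f; apply/ffunP => n; rewrite ffunE /=.
  by case: n => -[|[|[|//]]] ? /=; congr (f _); apply: val_inj.
by rewrite (reindex h) /=; [rewrite !pair_bigA | exact: onW_bij].
Qed.

(** The shift by 1/2 in [ch] cancels the scalar part, and the diagonal entries left over add up to
    traces. *)
Lemma ch0_eq0 T w : (forall a, \tr (T a) = 0) ->
  ch 0 ((2^-1 : R[i])%:A%:M + \sum_a mxtens (T a) (w a)) = 0.
Proof.
move=> trT; rewrite /ch sum_ffun_ord1 /=.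
under eq_bigr => i _.
  rewrite !ffunE !mxE sum_mxtensE !eqxx /= !mulr1n addrC addrK.
  over.
rewrite exchange_big big1 // => a _.
by rewrite -scaler_suml -/(mxtrace (T a)) trT scale0r.
Qed.

Lemma tens_mxtrace T T' w :
  \sum_i \sum_j tens ((\sum_a mxtens (T a) (w a)) i j)
                     ((\sum_a mxtens (T' a) (w a)) j i)
  = \sum_a \sum_b \tr (T a *m T' b) *: tens (w a) (w b).
Proof.
under eq_bigr => i _ do under eq_bigr => j _ do rewrite !sum_mxtensE tens_sum.
under eq_bigr => i _ do rewrite exchange_big.
rewrite exchange_big; apply: eq_bigr => a _.
under eq_bigr => i _ do rewrite exchange_big.
rewrite exchange_big; apply: eq_bigr => b _.
rewrite scaler_suml; apply: eq_bigr => i _.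
by rewrite mxE scaler_suml.
Qed.

Lemma ch_half_eq0 T T' w :
  mxstar (\sum_a mxtens (T a) (w a)) = \sum_a mxtens (T' a) (w a) ->
  (forall a b, \tr (T a *m T' b) = \tr (T' a *m T b)) ->
  ch_half (\sum_a mxtens (T a) (w a)) = 0.
Proof.
move=> starU trT; rewrite /ch_half starU.
under eq_bigr do rewrite big_split sumrN /=.
rewrite big_split /= sumrN !tens_mxtrace.
apply/eqP; rewrite subr_eq0; apply/eqP.
by apply: eq_bigr => a _; apply: eq_bigr => b _; rewrite trT.
Qed.

Lemma sum_mxtrace3 (M N P : 'M[R[i]]_q) :
  \sum_i \sum_j \sum_k M i j * N j k * P k i = \tr (M *m N *m P).
Proof.
rewrite /mxtrace; apply: eq_bigr => i _; rewrite mxE exchange_big.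
by apply: eq_bigr => k _; rewrite mxE mulr_suml.
Qed.

(** This removes the scalar part of an idempotent from every tensor slot but the first. *)
Lemma lpi_scale_one (c : R[i]) : lpi [set (1 : A)] (c *: 1) = 0.
Proof.
rewrite linearZ /= (_ : lpi _ 1 = 0) ?scaler0 //.
rewrite -(linear0 (lpi [set (1 : A)])); apply: lquot_eq; rewrite subr0.
exact: lspan_gen.
Qed.

(** The scalar part of [e] is cancelled by the shift in the first slot and is zero modulo constants
    in the other two. What remains is trilinear, with weights the traces of triple products. *)
Lemma ch1_eq0 T w : (forall a b c, \tr (T a *m T b *m T c) = 0) ->
  ch 1 ((2^-1 : R[i])%:A%:M + \sum_a mxtens (T a) (w a)) = 0.
Proof.
move=> trT; set e := _ + _; rewrite /ch sum_ffun_ord3 /=.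
have eE i j : e i j = 2^-1 *: (i == j)%:R + \sum_a T a i j *: w a.
  by rewrite mxE sum_mxtensE mxE; case: eqP; rewrite ?mulr1n ?mulr0n ?scaler0.
pose pw a := lpi [set (1 : A)] (w a).
have piE i j : lpi [set (1 : A)] (e i j) = \sum_a T a i j *: pw a.
  rewrite eE linearD /= -[(i == j)%:R]scaler_nat scalerA lpi_scale_one add0r.
  by rewrite linear_sum; apply: eq_bigr => a _; rewrite linearZ.
have inord1 : inord 1 = ordS ord0 :> 'I_3 by apply: val_inj; rewrite /= inordK.
have inord2 : inord 2 = ordS (ordS ord0) :> 'I_3.
  by apply: val_inj; rewrite /= inordK.
transitivity (\sum_(i < q) \sum_(j < q) \sum_(k < q)
    tens (tens (\sum_a T a i j *: w a) (\sum_b T b j k *: pw b))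
      (\sum_c T c k i *: pw c)).
  apply: eq_bigr => i _; apply: eq_bigr => j _; apply: eq_bigr => k _.
  by rewrite inord1 inord2 !ffunE /= eE [_ + _ - _]addrC addKr !piE.
pose F a b c := tens (tens (w a) (pw b)) (pw c).
transitivity (\sum_(i < q) \sum_(j < q) \sum_(k < q) \sum_a \sum_b \sum_c
    (T a i j * T b j k * T c k i) *: F a b c).
  apply: eq_bigr => i _; apply: eq_bigr => j _; apply: eq_bigr => k _.
  by rewrite tens_sum pair_bigA tens_sum /= -(pair_bigA _ (fun a b => \sum_c
    (T a i j * T b j k * T c k i) *: F a b c)).
(* The sums over [a], [b] and [c] are moved in turn outside the three sums over matrix indices. *)
under eq_bigr do under eq_bigr do rewrite exchange_big.
under eq_bigr do rewrite exchange_big.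
rewrite exchange_big big1 // => a _.
under eq_bigr do under eq_bigr do rewrite exchange_big.
under eq_bigr do rewrite exchange_big.
rewrite exchange_big big1 // => b _.
under eq_bigr do under eq_bigr do rewrite exchange_big.
under eq_bigr do rewrite exchange_big.
rewrite exchange_big big1 // => c _.
under eq_bigr do under eq_bigr do rewrite -scaler_suml.
under eq_bigr do rewrite -scaler_suml.
by rewrite -scaler_suml sum_mxtrace3 trT scale0r.
Qed.

End ChernTraces.

(** * Pauli matrices and the coefficients of the unitary *)

Section Pauli.
Variables (R : realType) (phi : 'I_3 -> R).
Local Notation s := (lift ord0).
Local Notation l k := (ordS k).
Local Notation m k := (ordS (ordS k)).
Local Notation "M ^H" := (map_mx Num.conj M^T) (at level 2, format "M ^H").

Lemma pauli_table (k : 'I_3) :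
  [/\ pauli R k *m pauli R k = 1%:M,
      pauli R (l k) *m pauli R (m k) = 'i%C *: pauli R k,
      pauli R (m k) *m pauli R (l k) = - 'i%C *: pauli R k,
      (pauli R k)^H = pauli R k
    & \tr (pauli R k) = 0].
Proof.
case: k => -[|[|[|//]]] k3; split; rewrite /mxtrace ?big_ord_recl ?big_ord0;
  try (apply/matrixP => -[[|[|//]] i2] [[|[|//]] j2]);
  rewrite !mxE ?big_ord_recl ?big_ord0 ?mxE /=;
  apply/eqP; rewrite eq_complex /=;
  by apply/andP; split; apply/eqP; ring.
Qed.

(* The coefficients of U for b = false, of its adjoint for b = true. *)
Definition unitary_coef (b : bool) (mu : 'I_4) : 'M[R[i]]_2 :=
  if unlift ord0 mu is Some k
  then (if b then - 'i%C * expi (- phi k) else 'i%C * expi (phi k)) *: pauli R k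
  else 1%:M.

Lemma unitary_coef0 b : unitary_coef b ord0 = 1%:M.
Proof. by rewrite /unitary_coef unlift_none. Qed.

Lemma unitary_coefS b k : unitary_coef b (s k)
  = (if b then - 'i%C * expi (- phi k) else 'i%C * expi (phi k)) *: pauli R k.
Proof. by rewrite /unitary_coef liftK. Qed.

Lemma unitary_coef_mxadj mu : (unitary_coef false mu)^H = unitary_coef true mu.
Proof.
case: (unliftP ord0 mu) => [k|] ->; last first.
  by rewrite !unitary_coef0 trmx1 map_mx1.
have [_ _ _ pk _] := pauli_table k.
rewrite !unitary_coefS linearZ /= map_mxZ pk /=; congr (_ *: _).
apply/eqP; rewrite eq_complex /= cosN sinN.
by apply/andP; split; apply/eqP; ring.
Qed.

(** The coefficient -i exp(-i phi_k) = -sin phi_k - i cos phi_k and its conjugate share their real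
    part, carried by [C k], and have opposite imaginary parts, carried by [B k]. Hence only [B k]
    depends on [b]. *)
Lemma unitary_table b :
  twisted_table phi (unitary_coef b) (unitary_coef (~~ b))
    (fun k => (if b then 'i%C else - 'i%C) *: pauli R k)
    (fun k => 'i%C *: pauli R k).
Proof.
have complex_eq (z z' : R[i]) :
    complex.Re z = complex.Re z' -> complex.Im z = complex.Im z' -> z = z'.
  by case: z z' => [x y] [x' y'] /= -> ->.
split=> [mu|k|k|k|k]; rewrite ?unitary_coef0 ?unitary_coefS.
- case: (unliftP ord0 mu) => [k|] ->; last by rewrite !unitary_coef0 mulmx1.
  have [kk _ _ _ _] := pauli_table k; have cs := cos2sin2 (phi k).
  rewrite !unitary_coefS -!scalemxAl -!scalemxAr kk !scalerA -[RHS]scale1r.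
  congr (_ *: _); case: b; apply: complex_eq => /=;
    by rewrite ?(cosN, sinN); ring: cs.
- rewrite mul1mx !scalerA -scalerDl.
  congr (_ *: _); case: b; apply: complex_eq => /=;
    by rewrite ?(cosN, sinN); ring.
- rewrite mulmx1 !scalerA -scalerDl.
  congr (_ *: _); case: b; apply: complex_eq => /=;
    by rewrite ?(cosN, sinN); ring.
- have [_ lm _ _ _] := pauli_table k.
  rewrite -!scalemxAl -!scalemxAr lm !scalerA -scalerBl cosB sinB.
  congr (_ *: _); case: b; apply: complex_eq => /=;
    by rewrite ?(cosN, sinN); ring.
- have [_ _ ml _ _] := pauli_table k.
  rewrite -!scalemxAl -!scalemxAr ml !scalerA -scalerBl cosB sinB.
  congr (_ *: _); case: b; apply: complex_eq => /=;
    by rewrite ?(cosN, sinN); ring.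
Qed.

(** Diagonal products are the identity on both sides; the others are multiples of Pauli matrices and
    have trace zero. *)
Lemma mxtrace_unitary_coef mu nu :
  \tr (unitary_coef false mu *m unitary_coef true nu)
  = \tr (unitary_coef true mu *m unitary_coef false nu).
Proof.
have [<-|mu_nu] := eqVneq mu nu.
  have [-> _ _ _ _] := unitary_table false.
  by have [-> _ _ _ _] := unitary_table true.
have tr0 b : \tr (unitary_coef b mu *m unitary_coef (~~ b) nu) = 0.
  rewrite -[X in \tr X]mulmx1.
  apply: (twisted_table_mxtrace (unitary_table b)) mu_nu => k;
    rewrite mulmx1 mxtraceZ; have [_ _ _ _ ->] := pauli_table k; exact: mulr0.
by rewrite (tr0 false) (tr0 true).
Qed.

End Pauli.

(** * Complex scalars acting on matrices over [A] *)

Section AlgebraScalars.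
Variables (K : fieldType) (A : algType K) (n : nat).

(** Scalars of ['M[A]_n] live in the possibly noncommutative [A]; those of the form [c%:A] are
    central and still cross a product. *)
Lemma mulmx_in_alg (c d : K) (M N : 'M[A]_n) :
  (c%:A *: M) *m (d%:A *: N) = (c * d)%:A *: (M *m N).
Proof.
apply/matrixP => i j; rewrite !mxE mulr_sumr; apply: eq_bigr => k _.
by rewrite !mxE !mulr_algl -scalerAl -scalerAr scalerA.
Qed.

End AlgebraScalars.

Lemma scale_in_alg_mxtens (R : realType) (A : starAlgType R) n (c : R[i])
    (M : 'M[R[i]]_n) (a : A) : c%:A *: mxtens M a = mxtens (c *: M) a.
Proof. by apply/matrixP => i j; rewrite !mxE mulr_algl scalerA. Qed.

Lemma big_option (V : nmodType) (I : finType) (F : option I -> V) :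
  \sum_a F a = \sum_i F (Some i) + F None.
Proof.
rewrite (bigD1 None) //= addrC; congr (_ + _).
rewrite (reindex_omap Some id) => [|[]] //=.
by apply: eq_bigl => i; rewrite eqxx.
Qed.

(** * The unitary over any algebra satisfying the relations of the 3-sphere *)

Section Unitary.
Variables (R : realType) (phi : 'I_3 -> R).

Lemma unitary_sum (A : starAlgType R) (v : 'I_4 -> A) :
  (v ord0)%:M + ('i%C : R[i])%:A *:
     \sum_(k < 3) mxtens (sigma_tilde phi k) (v (lift ord0 k))
  = \sum_mu mxtens (unitary_coef phi false mu) (v mu).
Proof.
rewrite [RHS]big_ord_recl unitary_coef0 mxtens1; congr (_ + _).
rewrite scaler_sumr; apply: eq_bigr => k _.
by rewrite scale_in_alg_mxtens unitary_coefS /sigma_tilde scalerA.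
Qed.

Lemma unitary_sum_mxstar (A : starAlgType R) (v : 'I_4 -> A) :
  (forall mu, star (v mu) = v mu) ->
  mxstar (\sum_mu mxtens (unitary_coef phi false mu) (v mu))
  = \sum_mu mxtens (unitary_coef phi true mu) (v mu).
Proof.
move=> v_herm; rewrite mxstar_sum; apply: eq_bigr => mu _.
by rewrite mxstar_mxtens unitary_coef_mxadj v_herm.
Qed.

Lemma unitary_of_relations (A : starAlgType R) (v : 'I_4 -> A) :
  (forall mu, star (v mu) = v mu) ->
  (forall k, relation1 phi v k = 0) -> (forall k, relation2 phi v k = 0) ->
  sum_squares v = 1 ->
  let U := (v ord0)%:M + ('i%C : R[i])%:A *:
    \sum_(k < 3) mxtens (sigma_tilde phi k) (v (lift ord0 k)) in
  (U *m mxstar U = 1%:M /\ mxstar U *m U = 1%:M) /\ ch_half U = 0.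
Proof.
move=> v_herm rel1 rel2 v_sphere; have v_star := unitary_sum_mxstar v_herm.
rewrite unitary_sum; split; last first.
  exact: ch_half_eq0 v_star (mxtrace_unitary_coef phi).
rewrite v_star (twisted_product (unitary_table phi false)) //.
by rewrite (twisted_product (unitary_table phi true)) // v_sphere.
Qed.

End Unitary.

(** * The projection over any algebra satisfying the relations of the 4-sphere *)

Section Projection.
Variables (R : realType) (phi : 'I_3 -> R) (gamma : 'I_4 -> 'M[R[i]]_4).
Hypothesis gamma_clifford : clifford gamma.
Variables (A : starAlgType R) (u : 'I_4 -> A) (u4 : A).
Hypotheses (u_rel1 : forall k, relation1 phi u k = 0)
  (u_rel2 : forall k, relation2 phi u k = 0)
  (u_herm : forall mu, star (u mu) = u mu) (u4_herm : star u4 = u4)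
  (u4_central : forall mu, u4 * u mu = u mu * u4)
  (u_sphere : sum_squares u + u4 ^+ 2 = 1).

Local Notation X := (\sum_(mu < 4) mxtens (gamma_tilde gamma phi mu) (u mu)
  + mxtens (gamma5 gamma) u4).

(** The cross terms cancel because gamma anticommutes with the twisted gammas while [u4] is central;
    the two squares add up to 1 by the sphere relation. *)
Lemma clifford_sum_sqr : X *m X = 1%:M.
Proof.
have tab := gamma_tilde_table gamma_clifford phi.
rewrite mulmxDl !mulmxDr (twisted_product tab) //.
rewrite mxtensM [gamma5 gamma *m _](gamma5_sqr gamma_clifford) -expr2 mxtens1.
rewrite addrA [X in X + _ = _](_ : _ = (sum_squares u)%:M); last first.
  rewrite -addrA -[RHS]addr0; congr (_ + _).
  rewrite mulmx_suml mulmx_sumr -big_split big1 //= => mu _.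
  rewrite !mxtensM !mulmxE u4_central (gamma_tilde_anticomm gamma_clifford).
  by rewrite -mxtensDl subrr mxtens0.
by rewrite -raddfD u_sphere.
Qed.

Local Notation e := ((2^-1 : R[i])%:A *:
  (1%:M + \sum_(mu < 4) mxtens (gamma_tilde gamma phi mu) (u mu)
   + mxtens (gamma5 gamma) u4)).

(** Absorbing 1/2 into the matrices gives the shape required by the vanishing criteria for [ch]. *)
Lemma projection_sum :
  e = (2^-1 : R[i])%:A%:M
    + \sum_a mxtens (2^-1 *: gamma_tilde5 gamma phi a) (oapp u u4 a).
Proof.
rewrite big_option /= -addrA scalerDr scalemx1; congr (_ + _).
rewrite scalerDr scaler_sumr !scale_in_alg_mxtens; congr (_ + _).
by apply: eq_bigr => mu _; rewrite scale_in_alg_mxtens.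
Qed.

(** As X squares to 1, the square of 1 + X is twice 1 + X. *)
Lemma projection_idem : e *m e = e.
Proof.
rewrite -addrA mulmx_in_alg mulmxDl mul1mx mulmxDr mulmx1 clifford_sum_sqr.
rewrite [X in _ + X]addrC scalerDr -scalerDl -scalerDl; congr (_%:A *: _).
by field.
Qed.

Lemma projection_mxstar : mxstar e = e.
Proof.
have half_real : (2^-1 : R[i])^* = 2^-1 by rewrite fmorphV rmorph_nat.
rewrite projection_sum mxstarD mxstar_sum; congr (_ + _).
  apply/matrixP => i j; rewrite !mxE eq_sym.
  by case: eqP; rewrite ?mulr1n ?mulr0n ?star0 // starZ half_real star1.
apply: eq_bigr => a _; rewrite mxstar_mxtens linearZ /= map_mxZ /= half_real.
congr (mxtens (_ *: _) _); case: a => [mu|] //=.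
  exact: gamma_tilde_mxadj.
exact: gamma5_mxadj.
Qed.

Lemma projection_of_relations :
  (e *m e = e /\ mxstar e = e) /\ ch 0 e = 0 /\ ch 1 e = 0.
Proof.
split; first by split; [exact: projection_idem | exact: projection_mxstar].
rewrite projection_sum; split.
  by apply: ch0_eq0 => a; rewrite mxtraceZ mxtrace_gamma_tilde5 ?mulr0.
apply: ch1_eq0 => a b c; rewrite -!(scalemxAl, scalemxAr) !mxtraceZ.
by rewrite [\tr _](mxtrace_gamma_tilde5_mul3 gamma_clifford) !mulr0.
Qed.

End Projection.

(** * Defining relations in the sphere algebras *)

Section Spheres.
Variables (R : realType) (phi : 'I_3 -> R).

Lemma spiB (A : starAlgType R) (S : star_relations A) :
  {morph spi S : x y / x - y}.
Proof. exact: raddfB. Qed.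

Lemma spi0 (A : starAlgType R) (S : star_relations A) : spi S 0 = 0.
Proof. exact: raddf0. Qed.

Lemma spi_relator (A : starAlgType R) (S : star_relations A) r :
  relators S r -> spi S r = 0.
Proof.
move=> Sr; rewrite -(spi0 S); apply/spiP; rewrite subr0.
exact: ideal_gen.
Qed.

Lemma spi_commute (A : starAlgType R) (S : star_relations A) x y :
  x * y = y * x -> spi S x * spi S y = spi S y * spi S x.
Proof. by move=> xy; rewrite -!spiM xy. Qed.

Lemma spi_comm_minus (A : starAlgType R) (S : star_relations A) x y :
  relators S (comm_minus x y) -> spi S x * spi S y = spi S y * spi S x.
Proof.
by move=> /spi_relator/eqP; rewrite spiB !spiM subr_eq0 => /eqP.
Qed.

Section SpiRelations.
Variables (A : starAlgType R) (S : star_relations A) (x : 'I_4 -> A).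

(** The projection is an algebra morphism. This is applied twice below, since the sphere algebras
    are quotients of quotients of free algebras. *)
Lemma relation1_spi k :
  relation1 phi (fun mu => spi S (x mu)) k = spi S (relation1 phi x k).
Proof.
by rewrite /relation1 /comm_minus /comm_plus spiB !spiZ spiB spiD !spiM.
Qed.

Lemma relation2_spi k :
  relation2 phi (fun mu => spi S (x mu)) k = spi S (relation2 phi x k).
Proof.
by rewrite /relation2 /comm_minus /comm_plus spiD !spiZ spiB spiD !spiM.
Qed.

Lemma sum_squares_spi :
  sum_squares (fun mu => spi S (x mu)) = spi S (sum_squares x).
Proof.
rewrite /sum_squares (big_morph _ (@spiD _ _ S) (spi0 S)).
by apply: eq_bigr => mu _; rewrite !expr2 spiM.
Qed.

End SpiRelations.

Lemma S3_relation1 k : relation1 phi (S3_v phi) k = 0.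
Proof.
rewrite !relation1_spi (spi_relator (S := R4_relations phi)) ?spi0 //.
by exists k; left.
Qed.

Lemma S3_relation2 k : relation2 phi (S3_v phi) k = 0.
Proof.
rewrite !relation2_spi (spi_relator (S := R4_relations phi)) ?spi0 //.
by exists k; right.
Qed.

Lemma S3_sum_squares : sum_squares (S3_v phi) = 1.
Proof.
apply/eqP; rewrite -subr_eq0 sum_squares_spi -spi1 -spiB spi_relator //.
Qed.

Lemma S3_star mu : star (S3_v phi mu) = S3_v phi mu.
Proof. by rewrite star_spi R4_x_herm. Qed.

Lemma S4_relation1 k : relation1 phi (S4_u phi) k = 0.
Proof.
rewrite !relation1_spi (spi_relator (S := R5_relations phi)) ?spi0 //.
by left; exists k; left.
Qed.

Lemma S4_relation2 k : relation2 phi (S4_u phi) k = 0.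
Proof.
rewrite !relation2_spi (spi_relator (S := R5_relations phi)) ?spi0 //.
by left; exists k; right.
Qed.

Lemma S4_sum_squares : sum_squares (S4_u phi) + S4_u4 phi ^+ 2 = 1.
Proof.
have /eqP : spi (S4_relations phi)
    (sum_squares (R5_x phi) + R5_x4 phi ^+ 2 - 1) = 0 by apply: spi_relator.
by rewrite spiB spiD expr2 spiM -sum_squares_spi subr_eq0 => /eqP.
Qed.

Lemma S4_central mu : S4_u4 phi * S4_u phi mu = S4_u phi mu * S4_u4 phi.
Proof.
by apply: spi_commute; apply: spi_comm_minus; right; exists mu.
Qed.

Lemma S4_star mu : star (S4_u phi mu) = S4_u phi mu.
Proof. by rewrite !star_spi star_freegen. Qed.

Lemma S4_star4 : star (S4_u4 phi) = S4_u4 phi.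
Proof. by rewrite !star_spi star_freegen. Qed.

End Spheres.

Theorem theorem2 (R : realType) (phi : 'I_3 -> R)
    (gamma : 'I_4 -> 'M[R[i]]_4) (gamma_clifford : clifford gamma) :
  let e : 'M[S4 phi]_4 :=
    (2^-1 : R[i])%:A *:
      (1%:M + \sum_(mu < 4) mxtens (gamma_tilde gamma phi mu) (S4_u phi mu)
       + mxtens (gamma5 gamma) (S4_u4 phi)) in
  let U : 'M[S3 phi]_2 :=
    (S3_v phi ord0)%:M
    + ('i%C : R[i])%:A *:
        \sum_(k < 3) mxtens (sigma_tilde phi k) (S3_v phi (lift ord0 k)) in
  ((e *m e = e /\ mxstar e = e) /\ ch 0 e = 0 /\ ch 1 e = 0) /\
  ((U *m mxstar U = 1%:M /\ mxstar U *m U = 1%:M) /\ ch_half U = 0).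
Proof.
split.
  apply: (projection_of_relations gamma_clifford).
  - exact: S4_relation1.
  - exact: S4_relation2.
  - exact: S4_star.
  - exact: S4_star4.
  - exact: S4_central.
  - exact: S4_sum_squares.
apply: unitary_of_relations.
- exact: S3_star.
- exact: S3_relation1.
- exact: S3_relation2.
- exact: S3_sum_squares.
Qed.
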